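(* Let $A$ be a labelled multiset of positive integers, and let $c\ge 1$ be an integer such that $x\ge c$ for every $x\in A$. Set \[ \Theta_{A,c}:=\widetilde F_{A\cup\{c\}}-\sum_{j=1}^{c-1}q^{j-1}C_j\bigl(\widetilde F_{A\cup\{c-j\}}\bigr). \] Then \[ \Theta_{A,c}=\sum_{T\subseteq A}\left(\sum_{b=1}^{S_T}\alpha_{T,b}\,C_{c+S_T-b}\bigl(\widetilde F_{(A\setminus T)\cup\{b\}}\bigr)+\beta_T\,C_{c+S_T}\bigl(\widetilde F_{A\setminus T}\bigr)\right), \] where \[ \alpha_{T,b}=\begin{cases}(|T|-1)!\displaystyle\sum_{\substack{x\in T\\ b\le x}}q^{(c+x-b-1)\bmod x}, & T\ne\emptyset,\\ 0, & T=\emptyset,\end{cases} \] and \[ \beta_T=(|T|+1)!\,[c]_q+|T|!\sum_{x\in T}\bigl(q^c+q^{c+1}+\cdots+q^{x-1}\bigr). \] Here $(c+x-b-1)\bmod x$ denotes the least nonnegative residue of $c+x-b-1$ modulo $x$, so that all coefficients $\alpha_{T,b}$ and $\beta_T$ lie in $\mathbb{N}[q]$.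
   Context: $\Lambda$ is the ring of symmetric functions in $X=x_1+x_2+\cdots$ over $\mathbb{Q}(q,t)$; $m_\mu,h_r,p_k$ are monomial, complete homogeneous and power-sum symmetric functions. $[n]_q=1+q+\cdots+q^{n-1}$; $\mathbb{N}[q]$ is the set of polynomials with nonnegative integer coefficients. Operators $C_a$ ($a\ge1$): $C_a$ is the linear operator on $\Lambda$ given by $C_a(f)[X]=\left(-\tfrac1q\right)^{a-1}\langle z^a\rangle\, f\!\left[X-\tfrac{1-1/q}{z}\right]\sum_{r\ge0}h_r[X]z^r$, where $\langle z^a\rangle$ takes the coefficient of $z^a$ and the plethystic evaluation replaces each $p_k$ in $f$ by $p_k[X]-(1-q^{-k})z^{-k}$. A labelled multiset $A$ is a finite multiset of positive integers in which copies of equal values are distinguished by labels, so it is treated as a finite set (subsets, unions, differences are ordinary set operations). In formulas an element stands for its integer value. $S_A=\sum_{x\in A}x$ (with $S_\emptyset=0$), and $|A|=\ell(A)$ is the number of elements. $\mu(A)$ is the partition whose parts are the values of the elements of $A$, and $m_i(A)$ is the multiplicity of $i$. Define $F_A=(-1)^{S_A-\ell(A)}m_{\mu(A)}$ and $\widetilde F_A=\bigl(\prod_{i\ge1}m_i(A)!\bigr)F_A$, with $\widetilde F_\emptyset=1$. Integers such as $c$, $c-j$, $b$ adjoined to a labelled multiset are regarded as new labelled elements. *)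

(* Defs.v *)
From HB Require Import structures.
From mathcomp Require Import all_boot all_order all_fingroup all_algebra.
From mathcomp Require Import boolp.
From mathcomp Require Import mpoly.

Set Implicit Arguments.
Unset Strict Implicit.
Unset Printing Implicit Defensive.

Import GRing.Theory.
Local Open Scope ring_scope.

(* A symmetric function over K is a family (f_n) of symmetric polynomials,     *)
(* f_n in n variables, of bounded degree and compatible with setting the last  *)
(* variable to 0: an element of the graded inverse limit of the rings of       *)
(* symmetric polynomials in n variables.                                       *)

Definition kill_last (K : fieldType) (n : nat) (p : {mpoly K[n.+1]}) :
    {mpoly K[n]} :=
  p \mPo [tuple (if insub (val i) is Some j then 'X_(j : 'I_n) else 0)
         | i < n.+1].

Definition sym_family (K : fieldType) (f : forall n, {mpoly K[n]}) : Prop :=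
  [/\ forall n, f n \is symmetric,
      forall n, kill_last (f n.+1) = f n
    & exists d, forall n, (msize (f n) <= d)%N].

Record symfun (K : fieldType) := SymFun {
  sf_fun : forall n, {mpoly K[n]};
  sf_prop : sym_family sf_fun }.

Lemma symfun_eq (K : fieldType) (f g : symfun K) :
  (forall n, sf_fun f n = sf_fun g n) -> f = g.
Proof.
case: f g => [f Hf] [g Hg] /= E.
have Efg : f = g by apply: functional_extensionality_dep.
by subst g; congr SymFun; apply: Prop_irrelevance.
Qed.

HB.instance Definition _ (K : fieldType) := gen_eqMixin (symfun K).
HB.instance Definition _ (K : fieldType) := gen_choiceMixin (symfun K).

Lemma sym_family0 (K : fieldType) : sym_family (fun n => 0 : {mpoly K[n]}).
Proof.
split=> [n|n|]; [exact: rpred0|exact: raddf0|].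
by exists 0%N => n; rewrite msize0.
Qed.

Lemma sym_family1 (K : fieldType) : sym_family (fun n => 1 : {mpoly K[n]}).
Proof.
split=> [n|n|]; [by apply/issymP => s; exact: msym1|exact: rmorph1|].
by exists 1%N => n; rewrite mmeasure1.
Qed.

Lemma sym_familyD (K : fieldType) (f g : symfun K) :
  sym_family (fun n => sf_fun f n + sf_fun g n).
Proof.
case: f g => [f [sf kf [d Hd]]] [g [sg kg [e He]]] /=; split=> [n|n|].
- apply/issymP => s; rewrite msymD.
  by rewrite (issymP _ (sf n)) (issymP _ (sg n)).
- by rewrite -(kf n) -(kg n); exact: raddfD.
- exists (maxn d e) => n; apply: leq_trans (msizeD_le _ _) _.
  by rewrite geq_max !leq_max Hd He orbT.
Qed.

Lemma sym_familyN (K : fieldType) (f : symfun K) :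
  sym_family (fun n => - sf_fun f n).
Proof.
case: f => [f [sf kf [d Hd]]] /=; split=> [n|n|].
- by apply/issymP => s; rewrite msymN (issymP _ (sf n)).
- by rewrite -(kf n); exact: raddfN.
- by exists d => n; rewrite msizeN.
Qed.

Lemma sym_familyM (K : fieldType) (f g : symfun K) :
  sym_family (fun n => sf_fun f n * sf_fun g n).
Proof.
case: f g => [f [sf kf [d Hd]]] [g [sg kg [e He]]] /=; split=> [n|n|].
- apply/issymP => s; rewrite msymM.
  by rewrite (issymP _ (sf n)) (issymP _ (sg n)).
- by rewrite -(kf n) -(kg n); exact: rmorphM.
- exists (d + e).+1 => n; apply: leq_trans (msizeM_le _ _) _.
  by rewrite ltnS; exact: leq_add.
Qed.

Lemma sym_familyZ (K : fieldType) (c : K) (f : symfun K) :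
  sym_family (fun n => c *: sf_fun f n).
Proof.
case: f => [f [sf kf [d Hd]]] /=; split=> [n|n|].
- by apply/issymP => s; rewrite msymZ (issymP _ (sf n)).
- by rewrite -(kf n); exact: linearZ.
- by exists d => n; apply: leq_trans (msizeZ_le _ _) _.
Qed.

Definition sf0 (K : fieldType) : symfun K := SymFun (@sym_family0 K).
Definition sf1 (K : fieldType) : symfun K := SymFun (@sym_family1 K).
Definition sfD (K : fieldType) (f g : symfun K) : symfun K :=
  SymFun (sym_familyD f g).
Definition sfN (K : fieldType) (f : symfun K) : symfun K :=
  SymFun (sym_familyN f).
Definition sfM (K : fieldType) (f g : symfun K) : symfun K :=
  SymFun (sym_familyM f g).
Definition sfZ (K : fieldType) (c : K) (f : symfun K) : symfun K :=
  SymFun (sym_familyZ c f).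

Lemma sfDA (K : fieldType) : associative (@sfD K).
Proof. by move=> f g h; apply: symfun_eq => n /=; rewrite addrA. Qed.
Lemma sfDC (K : fieldType) : commutative (@sfD K).
Proof. by move=> f g; apply: symfun_eq => n /=; rewrite addrC. Qed.
Lemma sf0D (K : fieldType) : left_id (sf0 K) (@sfD K).
Proof. by move=> f; apply: symfun_eq => n /=; rewrite add0r. Qed.
Lemma sfND (K : fieldType) : left_inverse (sf0 K) (@sfN K) (@sfD K).
Proof. by move=> f; apply: symfun_eq => n /=; rewrite addNr. Qed.

HB.instance Definition _ (K : fieldType) :=
  GRing.isZmodule.Build (symfun K) (@sfDA K) (@sfDC K) (@sf0D K) (@sfND K).

Lemma sfMA (K : fieldType) : associative (@sfM K).
Proof. by move=> f g h; apply: symfun_eq => n /=; rewrite mulrA. Qed.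
Lemma sfMC (K : fieldType) : commutative (@sfM K).
Proof. by move=> f g; apply: symfun_eq => n /=; rewrite mulrC. Qed.
Lemma sf1M (K : fieldType) : left_id (sf1 K) (@sfM K).
Proof. by move=> f; apply: symfun_eq => n /=; rewrite mul1r. Qed.
Lemma sfMDl (K : fieldType) : left_distributive (@sfM K) +%R.
Proof. by move=> f g h; apply: symfun_eq => n /=; rewrite mulrDl. Qed.
Lemma sf1_neq0 (K : fieldType) : sf1 K != 0.
Proof.
apply/eqP => /(congr1 (fun f => sf_fun f 0%N)) /= /eqP.
by rewrite oner_eq0.
Qed.

HB.instance Definition _ (K : fieldType) :=
  GRing.Zmodule_isComNzRing.Build (symfun K)
    (@sfMA K) (@sfMC K) (@sf1M K) (@sfMDl K) (@sf1_neq0 K).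

Lemma sfZA (K : fieldType) (a b : K) (f : symfun K) :
  sfZ a (sfZ b f) = sfZ (a * b) f.
Proof. by apply: symfun_eq => n /=; rewrite scalerA. Qed.
Lemma sf1Z (K : fieldType) : left_id 1 (@sfZ K).
Proof. by move=> f; apply: symfun_eq => n /=; rewrite scale1r. Qed.
Lemma sfZDr (K : fieldType) : right_distributive (@sfZ K) +%R.
Proof. by move=> c f g; apply: symfun_eq => n /=; rewrite scalerDr. Qed.
Lemma sfZDl (K : fieldType) (f : symfun K) :
  {morph (@sfZ K)^~ f : a b / a + b}.
Proof. by move=> a b; apply: symfun_eq => n /=; rewrite scalerDl. Qed.

HB.instance Definition _ (K : fieldType) :=
  GRing.Zmodule_isLmodule.Build K (symfun K)
    (@sfZA K) (@sf1Z K) (@sfZDr K) (@sfZDl K).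

Lemma sfZMl (K : fieldType) (c : K) (f g : symfun K) :
  c *: (f * g) = (c *: f) * g.
Proof. by apply: symfun_eq => n /=; rewrite scalerAl. Qed.

HB.instance Definition _ (K : fieldType) :=
  GRing.Lmodule_isLalgebra.Build K (symfun K) (@sfZMl K).
HB.instance Definition _ (K : fieldType) :=
  GRing.Lalgebra_isComAlgebra.Build K (symfun K).

(* The partition formed by the nonzero exponents of a monomial.                *)
Definition expart (n : nat) (m : 'X_{1..n}) : seq nat :=
  sort geq [seq e <- m | e != 0%N].

(* The sum of all monomials of degree d whose exponent partition satisfies P.  *)
Definition monosum (K : fieldType) (d : nat) (P : pred (seq nat)) (n : nat) :
    {mpoly K[n]} :=
  \sum_(m : 'X_{1..n < d.+1} | (mdeg m == d) && P (expart m)) 'X_[m].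

Lemma mcoeff_monosum (K : fieldType) d P n (m : 'X_{1..n}) :
  (monosum K d P n)@_m = ((mdeg m == d) && P (expart m))%:R.
Proof.
rewrite /monosum raddf_sum /=.
under eq_bigr do rewrite mcoeffX.
have [Hd|Hd] := eqVneq (mdeg m) d; last first.
  rewrite big1 //= => b /andP[/eqP Hb _].
  by case: eqP => // E; rewrite -E Hb eqxx in Hd.
have lm : (mdeg m < d.+1)%N by rewrite Hd.
rewrite andTb; case HP: (P _).
  rewrite (bigD1 (BMultinom lm)) /= ?Hd ?eqxx ?HP // big1 ?addr0 // => b.
  by case/andP=> _; rewrite -val_eqE /= => /negbTE->.
rewrite big1 // => b /andP[_ Hb].
by case: eqP => // E; rewrite -E Hb in HP.
Qed.

Lemma expart_sym n (m : 'X_{1..n}) (s : 'S_n) :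
  expart [multinom m (s i) | i < n] = expart m.
Proof.
apply/perm_sortP.
- by move=> x y; exact: leq_total.
- by move=> y x z /= h1 h2; apply: leq_trans h2 h1.
- by move=> x y; rewrite andbC; exact: anti_leq.
apply: perm_filter.
apply/tuple_permP; exists s.
by congr val; apply: eq_mktuple => i.
Qed.

Lemma mdeg_sym n (m : 'X_{1..n}) (s : 'S_n) :
  mdeg [multinom m (s i) | i < n] = mdeg m.
Proof.
rewrite !mdegE [RHS](reindex_inj (@perm_inj _ s)) /=.
by apply: eq_bigr => i _; rewrite mnmE.
Qed.

Lemma kill_lastX (K : fieldType) n (m : 'X_{1..n.+1}) :
  kill_last ('X_[m] : {mpoly K[n.+1]}) =
  0 ^+ m ord_max * 'X_[[multinom m (widen_ord (leqnSn n) i) | i < n]].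
Proof.
rewrite /kill_last comp_mpolyX big_ord_recr /= mulrC tnth_mktuple.
case: insubP => [j jn /= E|_]; first by rewrite /= ltnn in jn.
congr (_ * _); rewrite (mpolyXE K 1%g); apply: eq_bigr => i _.
rewrite tnth_mktuple perm1 mnmE; case: insubP => [j _ /= E|]; last by rewrite /= ltn_ord.
by congr ('X_ _ ^+ _); apply: val_inj.
Qed.

Lemma mcoeff_kill_last (K : fieldType) n (p : {mpoly K[n.+1]}) (m : 'X_{1..n}) :
  (kill_last p)@_m = p@_(mnmwiden m).
Proof.
rewrite [in RHS](mpolyE p) /kill_last comp_mpolyEX !raddf_sum /=.
apply: eq_bigr => k _; rewrite !mcoeffZ; congr (_ * _).
rewrite -/(kill_last _) kill_lastX mcoeffX.
have [/eqP k0|k0] := boolP (k ord_max == 0%N).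
  rewrite k0 expr0 mul1r mcoeffX; congr (_%:R); congr nat_of_bool.
  apply/eqP/eqP => [<-|->]; apply/mnmP => i; last first.
    by rewrite mnmE mnmwiden_widen.
  have [->|ni] := eqVneq i ord_max; first by rewrite mnmwiden_ordmax.
  have ltin : (i < n)%N.
    by rewrite ltn_neqAle -ltnS ltn_ord andbT; exact: ni.
  have -> : i = widen_ord (leqnSn n) (Ordinal ltin) by apply: val_inj.
  by rewrite mnmwiden_widen mnmE.
rewrite expr0n (negbTE k0) mul0r mcoeff0.
by case: eqP => // E; rewrite E mnmwiden_ordmax in k0.
Qed.

Lemma expart_widen n (m : 'X_{1..n}) : expart (mnmwiden m) = expart m.
Proof.
rewrite /expart; congr (sort _ _).
have -> : (mnmwiden m : seq nat) = rcons m 0%N by [].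
by rewrite filter_rcons.
Qed.

Lemma mdeg_widen n (m : 'X_{1..n}) : mdeg (mnmwiden m) = mdeg m.
Proof.
rewrite !mdegE big_ord_recr /= mnmwiden_ordmax addn0.
by apply: eq_bigr => i _; rewrite mnmwiden_widen.
Qed.

Lemma sym_family_monosum (K : fieldType) d P : sym_family (monosum K d P).
Proof.
split=> [n|n|].
- apply/issymP => s; apply/mpolyP => m.
  by rewrite mcoeff_sym !mcoeff_monosum expart_sym mdeg_sym.
- apply/mpolyP => m.
  by rewrite mcoeff_kill_last !mcoeff_monosum expart_widen mdeg_widen.
- exists d.+1 => n; apply: leq_trans (msize_sum _ _ _) _.
  apply/bigmax_leqP_seq => b _ _; rewrite mmeasureX; exact: (valP b).
Qed.

(* [mu] is meant to be a partition, i.e. weakly decreasing with positive parts. *)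
Definition msymf (K : fieldType) (mu : seq nat) : symfun K :=
  SymFun (sym_family_monosum K (sumn mu) (pred1 mu)).

Definition hsymf (K : fieldType) (r : nat) : symfun K :=
  SymFun (sym_family_monosum K r predT).

(* The power sum p_k is m_(k), for k >= 1.                                     *)
Definition psymf (K : fieldType) (k : nat) : symfun K := msymf K [:: k].

(* An expression of f as a polynomial in p_1, ..., p_N for some N: the i-th    *)
(* variable of g (counted from 0) stands for p_(i+1).                          *)
Definition is_pexpr (K : fieldType) (f : symfun K)
    (g : {N : nat & {mpoly K[N]}}) : Prop :=
  mmap (fun c => c%:A) (fun i : 'I_(tag g) => psymf K i.+1) (tagged g) = f.

(* In characteristic 0 every f has such an expression, unique up to the choice *)
(* of N, because the p_k freely generate the ring of symmetric functions.      *)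
Definition pexpr (K : fieldType) (f : symfun K) : {N : nat & {mpoly K[N]}} :=
  if pselect (exists g, is_pexpr f g) is left H then projT1 (cid H)
  else Tagged (fun N => {mpoly K[N]}) (0 : {mpoly K[0]}).

(* f[X - (1 - 1/q)/z], as a polynomial in 'X = 1/z with coefficients symmetric *)
(* functions.                                                                  *)
Definition pleth_shift (K : fieldType) (q : K) (f : symfun K) :
    {poly symfun K} :=
  mmap (fun c => (c%:A)%:P)
       (fun i : 'I_(tag (pexpr f)) =>
          (psymf K i.+1)%:P - (1 - q ^- i.+1)%:A *: 'X^(i.+1))
       (tagged (pexpr f)).

(* The coefficient of z^a in (sum_i u_i z^-i) (sum_r h_r z^r) is               *)
(* sum_i u_i h_(a+i).                                                          *)
Definition Cop (K : fieldType) (q : K) (a : nat) (f : symfun K) : symfun K :=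
  (- q^-1) ^+ a.-1 *:
    \sum_(i < size (pleth_shift q f)) (pleth_shift q f)`_i * hsymf K (a + i).

(* A labelled multiset is a finite set A of labels together with the value     *)
(* v x of each label x; the functions F_A depend only on the sequence of       *)
(* values, listed with repetition in any order, and adjoining a new labelled   *)
(* element b amounts to adding b to that sequence.                             *)
Definition lvalues (I : finType) (v : I -> nat) (A : {set I}) : seq nat :=
  [seq v x | x in A].

Definition lsum (I : finType) (v : I -> nat) (A : {set I}) : nat :=
  (\sum_(x in A) v x)%N.

Definition Fsym (K : fieldType) (s : seq nat) : symfun K :=
  (-1) ^+ (sumn s - size s) *: msymf K (sort geq s).

Definition Ftilde (K : fieldType) (s : seq nat) : symfun K :=
  (\prod_(i <- undup s) (count_mem i s)`!)%N%:R *: Fsym K s.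

Definition qint (K : fieldType) (q : K) (n : nat) : K := \sum_(i < n) q ^+ i.

Definition Theta (K : fieldType) (q : K) (I : finType) (v : I -> nat)
    (A : {set I}) (c : nat) : symfun K :=
  Ftilde K (c :: lvalues v A)
  - \sum_(1 <= j < c)
      q ^+ j.-1 *: Cop q j (Ftilde K ((c - j)%N :: lvalues v A)).

Definition alpha (K : fieldType) (q : K) (I : finType) (v : I -> nat)
    (c : nat) (T : {set I}) (b : nat) : K :=
  if T == set0 then 0
  else (#|T|.-1)`!%:R
       * \sum_(x in T | (b <= v x)%N) q ^+ ((c + v x - b - 1) %% v x).

Definition beta (K : fieldType) (q : K) (I : finType) (v : I -> nat)
    (c : nat) (T : {set I}) : K :=
  (#|T|.+1)`!%:R * qint q c
  + (#|T|)`!%:R * \sum_(x in T) \sum_(c <= i < v x) q ^+ i.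

(* Membership in N[q]: evaluations at q of polynomials with coefficients in N. *)
Definition in_Nq (K : fieldType) (q x : K) : Prop :=
  exists s : seq nat, x = \sum_(i < size s) (nth 0%N s i)%:R * q ^+ i.

(* The field Q(q,t) and its two generators.                                    *)
Definition Qqt : fieldType := {fraction {mpoly rat[2]}}.
Definition q_ : Qqt := tofrac ('X_ord0 : {mpoly rat[2]}).
Definition t_ : Qqt := tofrac ('X_ord_max : {mpoly rat[2]}).

(* Main.v *)
From HB Require Import structures.
Require Import Defs.
From mathcomp Require Import all_boot all_order all_algebra.
From mathcomp Require Import ring zify.
From mathcomp Require Import boolp.
From mathcomp Require Import mpoly.

Set Implicit Arguments.
Unset Strict Implicit.
Unset Printing Implicit Defensive.

Import GRing.Theory.
Local Open Scope ring_scope.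

(** Write F_A for the function attached to the labelled multiset A, S_T for the
    sum of the values of T, and H_n = (-1/q)^(n-1) h_n, which is C_n(1). Both
    sides of the theorem are expanded in the products H_m F_B, where B is a
    subset of A with at most one further element b adjoined, and then the
    coefficients agree one by one.

    The operator. The evaluation f[X - (1-1/q)/z] is the ring morphism that
    sends p_k to p_k - (1-q^-k) z^-k. It is well defined because a polynomial
    relation g between the power sums remains true when one substitutes u/q and
    m copies of u for extra variables; this is a polynomial identity in m which
    holds for all natural m, hence for m = -1 (shift_rel_zero). The functions
    F_A are generated from the power sums by a product rule: up to signs,
    p_k F_A is the sum of F_(A + k) and of the functions obtained by increasing
    one element of A by k (signed_psymf_Ftilde). Following this rule through
    the morphism gives, by induction on A,

      C_a(F_A) = H_a F_A - sum over nonempty T in A of D_T H_(a+S_T) F_(A - T),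
      D_T = (|T|-1)! * sum over x in T of (q^(S_T-x) - q^(S_T))

    (Cop_lvalues, and Cop_cons for a multiset with an adjoined element).

    The left side. Multiplying Newton's identity n h_n = sum of p_k h_(n-k) by
    F_A and applying the product rule gives a recursion on A for the sum of
    (-1)^j h_j F_(A + (n-j)), 0 <= j < n. Unrolling it removes the elements of a
    subset T of A one after the other (altsumE); the factorials count the
    orders of removal. For n = c this sum is the part of Theta in which no
    element has been removed by the operators.

    The comparison. On the right side, T is removed first and then a subset U of
    the rest by the operator; what remains depends only on the union V of T and
    U, so each coefficient becomes a sum over the subsets T of V. These sums are
    evaluated by a telescoping argument: D_U is a difference of sums over the
    elements y of U, one of the powers q^(S_(U - y)) and one of the powers
    q^(S_U), and reindexing the first by U - y cancels nearly everything
    (sum_fact_detach, sum_factS_detach, sum_fact_card_detach). The hypothesis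
    that c is at most every element of A enters through the exponent
    (c+x-b-1) mod x, which it makes explicit (alpha_termE). *)

(** * Sums over subsets *)

Section SubsetSums.
Variables (R : nmodType) (I : finType).
Implicit Types (A T U V W : {set I}).

Lemma sum_subset_mem A a (F : {set I} -> R) : a \in A ->
  \sum_(T : {set I} | (T \subset A) && (a \in T)) F T =
  \sum_(T : {set I} | T \subset A :\ a) F (a |: T).
Proof.
move=> aA; rewrite [RHS](reindex_onto (fun T => T :\ a) (fun T => a |: T)) /=.
  apply: eq_big => [T|T /andP[_ aT]]; last by rewrite setD1K.
  apply/andP/andP => [[sTA aT]|[sTA /eqP eT]].
    by rewrite setSD //= setD1K.
  have aT : a \in T by rewrite -eT setU11.
  by rewrite -eT subUset sub1set aA (subset_trans sTA (subD1set _ _)) setU11.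
by move=> T sTA; rewrite setU1K //; apply: contraL sTA => aT;
   apply/negP => /subsetP/(_ _ aT); rewrite !inE eqxx.
Qed.

Lemma sum_subset_split A a (F : {set I} -> R) : a \in A ->
  \sum_(T : {set I} | T \subset A) F T =
  \sum_(T : {set I} | T \subset A :\ a) F T
  + \sum_(T : {set I} | T \subset A :\ a) F (a |: T).
Proof.
move=> aA; rewrite -(sum_subset_mem _ aA) (bigID (fun T => a \in T)) /= addrC.
by congr (_ + _); apply: eq_bigl => T; rewrite subsetD1.
Qed.

Lemma exchange_sum_subset_mem A (F : I -> {set I} -> R) :
  \sum_(T : {set I} | T \subset A) \sum_(x in T) F x T =
  \sum_(x in A) \sum_(T : {set I} | T \subset A :\ x) F x (x |: T).
Proof.
transitivity (\sum_(x in A)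
    \sum_(T : {set I} | (T \subset A) && (x \in T)) F x T).
  rewrite (exchange_big_dep (mem A)) //= => T x sTA; exact: (subsetP sTA).
by apply: eq_bigr => x xA; rewrite sum_subset_mem.
Qed.

Lemma sum_subset_compl V (F : {set I} -> {set I} -> R) :
  \sum_(T : {set I} | T \subset V) F T (V :\: T) =
  \sum_(T : {set I} | T \subset V) F (V :\: T) T.
Proof.
have DK T : T \subset V -> V :\: (V :\: T) = T.
  by move=> sT; rewrite setDDr setDv set0U; apply/setIidPr.
rewrite (reindex_onto (fun T => V :\: T) (fun T => V :\: T)) //=.
apply: eq_big => [T|T /andP[_ /eqP->] //].
rewrite subsetDl /=; apply/eqP/idP => [<-|/DK //]; exact: subsetDl.
Qed.

Lemma sum_subset_pair A (F : {set I} -> {set I} -> R) :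
  \sum_(T : {set I} | T \subset A) \sum_(U : {set I} | U \subset A :\: T) F T U =
  \sum_(V : {set I} | V \subset A) \sum_(T : {set I} | T \subset V) F T (V :\: T).
Proof.
rewrite [RHS](exchange_big_dep (fun T => T \subset A)) /=; last first.
  by move=> V T sV sT; exact: subset_trans sV.
apply: eq_bigr => T sTA.
rewrite [RHS](reindex_onto (fun U => T :|: U) (fun V => V :\: T)) /=; last first.
  by move=> V /andP[_ sTV]; rewrite -[RHS](setID V T) (setIidPr sTV).
have e U : ((T :|: U \subset A) && (T \subset T :|: U)
            && ((T :|: U) :\: T == U)) = (U \subset A :\: T).
  rewrite subsetUl andbT subUset sTA /= setDUl setDv set0U subsetD disjoint_sym.
  congr (_ && _); apply/eqP/idP => [<-|].
    by rewrite disjoint_sym disjoints_subset subsetDr.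
  by rewrite disjoint_sym => /setDidPl.
by apply: eq_big => [U|U]; rewrite -?e // => /andP[_ /eqP->].
Qed.

End SubsetSums.

(** * Weights of removed subsets and their summation formulas *)
Section Identities.
Variables (K : comNzRingType) (q : K) (I : finType) (v : I -> nat).
Implicit Types (A T U V W : {set I}).

Lemma lsum0 : lsum v set0 = 0%N.
Proof. by rewrite /lsum big_set0. Qed.

Lemma lsumD1 A x : x \in A -> lsum v A = (v x + lsum v (A :\ x))%N.
Proof. by move=> xA; rewrite /lsum (big_setD1 x). Qed.

Lemma lsumU1 A x : x \notin A -> lsum v (x |: A) = (v x + lsum v A)%N.
Proof. by move=> xA; rewrite /lsum big_setU1. Qed.

Lemma lsumDS A T : T \subset A -> lsum v A = (lsum v T + lsum v (A :\: T))%N.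
Proof. by move=> sT; rewrite /lsum (big_setID T) /= (setIidPr sT). Qed.

Lemma leq_lsum A x : x \in A -> (v x <= lsum v A)%N.
Proof. by move/lsumD1->; rewrite leq_addr. Qed.

(** A pair (U, y) with y in U is the same as a pair (U', y) with y outside
    U' = U - y, and each U' occurs for #|W| - #|U'| values of y. *)
Lemma exchange_sum_remove W (g : nat -> K) (P : {set I} -> K) :
  \sum_(U : {set I} | U \subset W) g #|U| * \sum_(y in U) P (U :\ y) =
  \sum_(U : {set I} | U \subset W) g #|U|.+1 * (#|W| - #|U|)%:R * P U.
Proof.
under eq_bigr do rewrite mulr_sumr.
rewrite (exchange_sum_subset_mem W (fun y U => g #|U| * P (U :\ y))).
transitivity (\sum_(U : {set I} | U \subset W) \sum_(y in W :\: U) g #|U|.+1 * P U).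
  rewrite [RHS](exchange_big_dep (mem W)) /=; last first.
    by move=> U y _ /setDP[].
  apply: eq_bigr => y yW; apply: eq_big => [U|U]; rewrite subsetD1 ?inE ?yW ?andbT //.
  by case/andP=> _ yU; rewrite setU1K // cardsU1 yU.
apply: eq_bigr => U sU; rewrite sumr_const cardsDS //.
by rewrite mulrAC -[LHS]mulr_natr.
Qed.

(** The number D_T for which C_a(F_A) contains - D_T H_(a+S_T) F_(A - T). *)
Definition detach_weight T : K :=
  (#|T|.-1)`!%:R * \sum_(x in T) (q ^+ (lsum v T - v x) - q ^+ lsum v T).

Lemma detach_weight0 : detach_weight set0 = 0.
Proof. by rewrite /detach_weight big_set0 mulr0. Qed.

(** The two halves of D_U both become multiples of q^(S_U): the second is so
    already, the first after naming U the set that remains when the element of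
    the inner sum is removed. The three evaluations below are instances in
    which the resulting coefficients cancel or collapse. *)
Lemma sum_detach_reindex W (g : nat -> K) :
  \sum_(U : {set I} | U \subset W) g #|U| * detach_weight U =
  \sum_(U : {set I} | U \subset W)
     (g #|U|.+1 * #|U|`!%:R * (#|W| - #|U|)%:R
      - g #|U| * (#|U|.-1)`!%:R * #|U|%:R) * q ^+ lsum v U.
Proof.
transitivity (\sum_(U : {set I} | U \subset W)
   ((g #|U| * (#|U|.-1)`!%:R) * (\sum_(y in U) q ^+ lsum v (U :\ y))
    - g #|U| * (#|U|.-1)`!%:R * #|U|%:R * q ^+ lsum v U)).
  apply: eq_bigr => U sU; rewrite /detach_weight sumrB sumr_const -[q ^+ _ *+ _]mulr_natl.
  rewrite !mulrBr !mulrA; congr (_ * _ - _); apply: eq_bigr => y yU.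
  by rewrite (lsumD1 yU) addKn.
have /= E := exchange_sum_remove W (fun n => g n * (n.-1)`!%:R)
  (fun U => q ^+ lsum v U).
by rewrite sumrB E -sumrB; apply: eq_bigr => U _; rewrite mulrBl.
Qed.

(** Here g n = (#|W| - n)!, and the reindexed coefficient of q^(S_U) vanishes
    unless U is empty or all of W. In terms of the orderings w_1, w_2, ... of W,
    the differences (1 - q^(w_i)) q^(w_(i+1) + w_(i+2) + ...) telescope. *)
Lemma sum_fact_detach W :
  \sum_(T : {set I} | T \subset W) #|T|`!%:R * detach_weight (W :\: T) =
  #|W|`!%:R * (1 - q ^+ lsum v W).
Proof.
rewrite (sum_subset_compl W (fun T U => #|T|`!%:R * detach_weight U)).
transitivity (\sum_(U : {set I} | U \subset W) (#|W| - #|U|)`!%:R * detach_weight U).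
  by apply: eq_bigr => U sU; rewrite cardsDS.
rewrite (sum_detach_reindex W (fun n => (#|W| - n)`!%:R)).
have [->|W0] := eqVneq W set0.
  under eq_bigl do rewrite subset0.
  by rewrite big_pred1_eq cards0 lsum0 !sub0n /=; ring.
rewrite (bigD1 set0) ?sub0set //= (bigD1 W) /=; last by rewrite subxx.
rewrite big1 ?addr0 => [|U /andP[/andP[sUW U0] UW]]; last first.
  have cU : (0 < #|U|)%N by rewrite card_gt0.
  have cW : (#|U| < #|W|)%N by rewrite proper_card // properEneq UW.
  have -> : (#|W| - #|U| = (#|W| - #|U|.+1).+1)%N by lia.
  by case: #|U| cU => // n _; rewrite /= !factS !natrM; ring.
have cW : (0 < #|W|)%N by rewrite card_gt0.
rewrite cards0 lsum0 subnn subn0; case: #|W| cW => // n _.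
by rewrite subn1 /= fact0 !factS !natrM; ring.
Qed.

(** With one more factor #|T|.+1 the cancellation is incomplete: every subset U
    of W leaves - #|W - U|! #|U|! q^(S_U). *)
Lemma sum_factS_detach W :
  \sum_(T : {set I} | T \subset W) #|T|.+1`!%:R * detach_weight (W :\: T) =
  #|W|.+1`!%:R
  - \sum_(T : {set I} | T \subset W)
      #|T|`!%:R * #|W :\: T|`!%:R * q ^+ lsum v (W :\: T).
Proof.
rewrite (sum_subset_compl W (fun T U => #|T|.+1`!%:R * detach_weight U)).
rewrite (sum_subset_compl W
  (fun T U => #|T|`!%:R * #|U|`!%:R * q ^+ lsum v U)).
transitivity (\sum_(U : {set I} | U \subset W) (#|W| - #|U|).+1`!%:R * detach_weight U).
  by apply: eq_bigr => U sU; rewrite cardsDS.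
rewrite (sum_detach_reindex W (fun n => (#|W| - n).+1`!%:R)).
apply/eqP; rewrite -subr_eq opprK; apply/eqP.
rewrite -big_split /= (bigD1 set0) ?sub0set //= big1 ?addr0.
  rewrite cards0 lsum0 setD0 subn0 subn1 /=.
  case: #|W| => [|n] /=; rewrite ?subn1 /= ?factS ?natrM ?fact0; first by ring.
  by rewrite -[n.+2%:R]natr1; ring.
move=> U /andP[sU U0]; rewrite cardsDS //.
have cU : (0 < #|U|)%N by rewrite card_gt0.
have cW := subset_leq_card sU.
move: cU cW; case: #|U| => // m _ cW.
case e : (#|W| - m.+1)%N => [|k] /=.
  by rewrite mulr0 !factS !natrM fact0; ring.
have -> : (#|W| - m.+2 = k)%N by lia.
by rewrite !factS !natrM -![_.+2%:R]natr1; ring.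
Qed.

(** The factor #|U| turns the cancellation around: the reindexed sum cancels the
    first term of each bracket, and only U = W is left. *)
Lemma sum_fact_card_detach W :
  \sum_(T : {set I} | T \subset W)
     #|T|`!%:R * (#|W :\: T|`!%:R * q ^+ lsum v (W :\: T)
                  - #|W :\: T|%:R * detach_weight (W :\: T)) =
  #|W|.+1`!%:R * q ^+ lsum v W.
Proof.
rewrite (sum_subset_compl W (fun T U =>
  #|T|`!%:R * (#|U|`!%:R * q ^+ lsum v U - #|U|%:R * detach_weight U))).
transitivity (\sum_(U : {set I} | U \subset W)
    (#|W| - #|U|)`!%:R * (#|U|`!%:R * q ^+ lsum v U)
  - \sum_(U : {set I} | U \subset W) ((#|W| - #|U|)`!%:R * #|U|%:R) * detach_weight U).
  rewrite -sumrB; apply: eq_bigr => U sU; rewrite cardsDS //; ring.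
rewrite (sum_detach_reindex W (fun n => (#|W| - n)`!%:R * n%:R)) -sumrB.
rewrite (bigD1 W) //= big1 ?addr0.
  rewrite !subnn fact0 subnS subnn.
  by case: #|W| => [|n] /=; rewrite ?factS ?natrM -?natr1; ring.
move=> U /andP[sU UW].
have cW : (#|U| < #|W|)%N by rewrite proper_card // properEneq UW.
have -> : (#|W| - #|U| = (#|W| - #|U|.+1).+1)%N by lia.
by case: #|U| => [|n] /=; rewrite !factS ?natrM -?[_.+1%:R]natr1; ring.
Qed.

End Identities.

(** * The product rule for augmented monomial functions *)
Section Injsum.
Variables (K : fieldType) (n : nat).
Implicit Types (D : {set 'I_n}) (s : seq nat) (m : 'X_{1..n}).

Definition powsum k D : {mpoly K[n]} := \sum_(j in D) 'X_j ^+ k.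

(** The augmented monomial polynomial: the sum, over the injective assignments
    of the entries of s to variables in D, of the products of the assigned
    powers. The set D of variables still available makes the recursion work. *)
Fixpoint injsum s D : {mpoly K[n]} :=
  if s is k :: s' then \sum_(j in D) 'X_j ^+ k * injsum s' (D :\ j) else 1.

Fixpoint bumps k s : seq (seq nat) :=
  if s is l :: s' then (l + k :: s')%N :: [seq l :: t | t <- bumps k s'] else [::].

Lemma injsum_swap k l s D : injsum (k :: l :: s) D = injsum (l :: k :: s) D.
Proof.
rewrite /=; under eq_bigr do rewrite big_distrr /=.
under [RHS]eq_bigr do rewrite big_distrr /=.
rewrite (exchange_big_dep (mem D)) /=; last by move=> i j _ /setD1P[].
apply: eq_bigr => i iD; apply: eq_big => [j|j _]; last by rewrite mulrCA setDDl setUC -setDDl.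
by rewrite !inE iD eq_sym andbT andbC.
Qed.

(** The variable carrying the new power either differs from all those assigned
    to s, or coincides with exactly one of them, whose exponent then grows. *)
Lemma powsum_injsum k s D :
  powsum k D * injsum s D =
  injsum (k :: s) D + \sum_(t <- bumps k s) injsum t D.
Proof.
elim: s D => [|l s IHs] D.
  by rewrite big_nil addr0 mulr1; apply: eq_bigr => j _; rewrite mulr1.
rewrite injsum_swap /= big_cons big_map /= big_distrr /=.
rewrite [X in _ + (_ + X)]exchange_big /= addrCA addrC -2!big_split /=; apply: eq_bigr => j jD.
rewrite -mulr_sumr -mulrDr -IHs exprD mulrCA -mulrA -mulrDr; congr (_ * _).
by rewrite {1}/powsum (big_setD1 j) //= mulrDl addrC.
Qed.

Lemma mnm_mulU_le (j : 'I_n) k m : (k <= m j)%N -> (U_(j) *+ k <= m)%MM.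
Proof.
move=> km; apply/mnm_lepP => i; rewrite mulmnE mnm1E.
by case: eqP => [<-|_]; rewrite ?mul1n.
Qed.

Lemma mcoeff_XnM (j : 'I_n) k (p : {mpoly K[n]}) m :
  ('X_j ^+ k * p)@_m = if (k <= m j)%N then p@_(m - U_(j) *+ k) else 0.
Proof.
rewrite mpolyXn mulrC; case: leqP => [km|mk].
  rewrite -[in LHS](submK (mnm_mulU_le km)).
  by rewrite addmC mcoeffMX.
rewrite [p]mpolyE mulr_suml raddf_sum big1 //= => m' _.
rewrite -scalerAl mcoeffZ -mpolyXD mcoeffX.
case: eqP => [E|_]; last by rewrite mulr0.
by move: mk; rewrite -E mnmDE mulmnE mnm1E eqxx mul1n ltnNge leq_addl.
Qed.

Definition positive_part m : seq nat := [seq e <- m | e != 0%N].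

Lemma mnm_enum m : (m : seq nat) = [seq m i | i <- enum 'I_n].
Proof.
have {1}-> : m = [multinom m i | i < n] by apply/mnmP => i; rewrite mnmE.
by [].
Qed.

Lemma positive_partB m j k : m j = k -> k != 0%N ->
  perm_eq (positive_part m) (k :: positive_part (m - U_(j) *+ k)%MM).
Proof.
move=> mj k0; rewrite /positive_part !mnm_enum.
have pj : perm_eq (enum 'I_n) (j :: rem j (enum 'I_n)).
  by apply: perm_to_rem; rewrite mem_enum.
have := perm_filter (fun e => e != 0%N) (perm_map m pj).
rewrite /= mj k0 => /perm_trans; apply; rewrite perm_cons.
have := perm_filter (fun e => e != 0%N) (perm_map (m - U_(j) *+ k)%MM pj).
rewrite /= mnmBE mulmnE mnm1E eqxx mul1n mj subnn /= perm_sym => /(perm_trans _); apply.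
set r := rem j _; have -> // : [seq m i | i <- r] = [seq (m - U_(j) *+ k)%MM i | i <- r].
apply/eq_in_map => i; rewrite mem_rem_uniq ?enum_uniq // inE => /andP[ij _].
by rewrite mnmBE mulmnE mnm1E eq_sym (negbTE ij) mul0n subn0.
Qed.

Definition mult_fact s : nat := (\prod_(i <- undup s) (count_mem i s)`!)%N.

Lemma mult_fact_cons k s : mult_fact (k :: s) = ((count_mem k s).+1 * mult_fact s)%N.
Proof.
have ext (t : seq nat) : {subset t <= k :: s} ->
    mult_fact t = (\prod_(i <- undup (k :: s)) (count_mem i t)`!)%N.
  move=> st; have e1 : (\prod_(i <- undup (k :: s) | i \notin t) (count_mem i t)`! = 1)%N.
    by apply: big1 => i /count_memPn->.
  rewrite (bigID (mem t)) e1 [RHS]muln1 -big_filter; apply: perm_big.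
  apply: uniq_perm;
    [exact: undup_uniq|exact/filter_uniq/(undup_uniq (k :: s))|].
  move=> i; rewrite mem_undup mem_filter (mem_undup (k :: s)).
  by apply/idP/andP => [it|[]//]; split=> //; exact: st.
have ss : {subset s <= k :: s} by move=> i; rewrite inE orbC => ->.
rewrite (ext _ ss) (ext (k :: s)) //.
have ku : k \in undup (k :: s) by rewrite mem_undup mem_head.
have uu := undup_uniq (k :: s).
rewrite (bigD1_seq k ku uu) [in RHS](bigD1_seq k ku uu) /= eqxx add1n factS.
rewrite -mulnA; congr (_ * (_ * _))%N.
by apply: eq_bigr => i ik; rewrite eq_sym (negbTE ik).
Qed.

Definition supported_on m D := [forall i, (i \notin D) ==> (m i == 0%N)].

(** Augmented monomials are monomial functions multiplied by the factorials of
    the multiplicities: if the first entry of s is k, then it may go to any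
    variable of exponent k, and their number is the multiplicity of k. *)
Lemma mcoeff_injsum s D m : all (fun k => 0 < k)%N s ->
  (injsum s D)@_m =
  ((supported_on m D && perm_eq (positive_part m) s) * mult_fact s)%:R.
Proof.
elim: s D m => [|k s IHs] D m /=.
  move=> _; rewrite mcoeff1 /mult_fact big_nil muln1; congr (nat_of_bool _)%:R.
  apply/eqP/andP => [->|[_ /perm_nilP]].
    split; first by apply/forallP => i; rewrite mnmE eqxx implybT.
    rewrite /positive_part mnm_enum; apply/perm_nilP.
    by elim: (enum _) => //= i e; rewrite mnmE.
  move=> e; apply/mnmP => i; rewrite mnmE; apply/eqP; apply/negPn/negP => mi.
  have : m i \in positive_part m.
    by rewrite mem_filter mi mnm_enum map_f ?mem_enum.
  by rewrite e.
case/andP=> k0 s0; rewrite raddf_sum /=.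
set good := _ && _.
transitivity (\sum_(j in D) ((m j == k) * good * mult_fact s)%:R : K).
  apply: eq_bigr => j jD; rewrite mcoeff_XnM; case: leqP => [km|mk]; last first.
    by case: eqP => // E; rewrite E ltnn in mk.
  rewrite IHs //; congr (_ * _)%:R.
  have sj : supported_on (m - U_(j) *+ k)%MM (D :\ j) = (m j == k) && supported_on m D.
    apply/forallP/andP => [H|[/eqP mj /forallP H] i].
      have := H j; rewrite !inE eqxx /= mnmBE mulmnE mnm1E eqxx mul1n => mj.
      split; first by rewrite eqn_leq km andbT -subn_eq0.
      apply/forallP => i; have := H i; rewrite !inE mnmBE mulmnE mnm1E.
      case: (eqVneq i j) => [->|ij] /=; first by rewrite jD.
      by rewrite mul0n subn0.
    have := H i; rewrite !inE mnmBE mulmnE mnm1E.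
    case: (eqVneq j i) => [<-|ij] /=; first by rewrite mj mul1n subnn.
    by rewrite mul0n subn0.
  rewrite sj /good; case: eqP => //= mj; rewrite mul1n; congr (nat_of_bool (_ && _)).
  have k1 : k != 0%N by rewrite -lt0n.
  by rewrite (permPl (positive_partB mj k1)) perm_cons.
rewrite -natr_sum; congr _%:R; rewrite mult_fact_cons mulnA.
rewrite -big_distrl -big_distrl /=; congr (_ * _)%N.
case e: good; last by rewrite muln0.
rewrite muln1 mul1n; case/andP: e => sm /permP/(_ (pred1 k)) /=.
rewrite eqxx add1n => <-; rewrite /positive_part count_filter mnm_enum count_map.
transitivity (\sum_(i in D | m i == k) 1)%N.
  by rewrite big_mkcondr; apply: eq_bigr => i _; case: eqP.
rewrite -sum1_count [RHS]big_enum_cond; apply: eq_bigl => i /=.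
rewrite andbC; apply: andb_id2l => /eqP mi; rewrite mi -lt0n k0.
apply: contraT => iD; move/forallP/(_ i): sm; rewrite iD mi /=.
by rewrite gtn_eqF.
Qed.

End Injsum.

Section SymmetricFunctions.
Variable K : fieldType.

Definition posseq (s : seq nat) := all (fun k => 0 < k)%N s.

Definition augmented_msymf (s : seq nat) : symfun K :=
  (mult_fact s)%:R *: msymf K (sort geq s).

Lemma geq_total : total geq. Proof. by move=> x y; exact: leq_total. Qed.
Lemma geq_trans : transitive geq.
Proof. by move=> y x z /= h1 h2; apply: leq_trans h2 h1. Qed.
Lemma geq_anti : antisymmetric geq.
Proof. by move=> x y; rewrite andbC; exact: anti_leq. Qed.

Lemma sumn_positive_part n (m : 'X_{1..n}) : sumn (positive_part m) = mdeg m.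
Proof.
rewrite mdegE /positive_part mnm_enum -[RHS]big_enum /=.
elim: (enum _) => [|i e IH] /=; first by rewrite big_nil.
by rewrite big_cons -IH; case: eqP => [->|].
Qed.

Lemma sf_fun_augmented_msymf s n : posseq s ->
  sf_fun (augmented_msymf s) n = injsum K s [set: 'I_n].
Proof.
move=> s0; apply/mpolyP => m; rewrite mcoeff_injsum //= mcoeffZ mcoeff_monosum.
rewrite -natrM mulnC; congr (nat_of_bool _ * _)%:R.
have -> : supported_on m [set: 'I_n] by apply/forallP => i; rewrite inE.
rewrite /= /expart -/(positive_part m).
rewrite (sameP eqP (perm_sortP geq_total geq_trans geq_anti _ _)).
case: (boolP (perm_eq _ _)) => // pm; last by rewrite andbF.
rewrite andbT (perm_sumn (s2 := s)); last by rewrite perm_sort.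
by rewrite -(perm_sumn pm) sumn_positive_part eqxx.
Qed.

Lemma perm_mult_fact s t : perm_eq s t -> mult_fact s = mult_fact t.
Proof.
move=> st; rewrite /mult_fact (perm_big (undup t)) ?perm_undup //=; last exact: perm_mem.
by apply: eq_bigr => i _; rewrite (permP st).
Qed.

Lemma perm_Ftilde s t : perm_eq s t -> Ftilde K s = Ftilde K t.
Proof.
move=> st; rewrite /Ftilde -!/(mult_fact _) (perm_mult_fact st) /Fsym.
rewrite (perm_sumn st) (perm_size st).
by rewrite (perm_sortP geq_total geq_trans geq_anti _ _ st).
Qed.

Lemma size_leq_sumn s : posseq s -> (size s <= sumn s)%N.
Proof. by elim: s => //= k s IH /andP[k0 /IH h]; lia. Qed.

Lemma FtildeE s : Ftilde K s = (-1) ^+ (sumn s - size s) *: augmented_msymf s.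
Proof. by rewrite /Ftilde /Fsym /augmented_msymf !scalerA mulrC. Qed.

Lemma Ftilde_nil : Ftilde K [::] = 1.
Proof.
rewrite FtildeE expr0 scale1r; apply: symfun_eq => n.
by rewrite sf_fun_augmented_msymf.
Qed.

Lemma posseq_bumps k s t : posseq s -> t \in bumps k s ->
  [/\ posseq t, sumn t = (sumn s + k)%N & size t = size s].
Proof.
rewrite /posseq; elim: s t => //= l s IHs t /andP[l0 s0]; rewrite inE => /orP[/eqP->|].
  by rewrite /= s0 addn_gt0 l0; split=> //=; lia.
case/mapP=> r /(IHs _ s0)[r0 er es] -> /=.
by rewrite l0 r0 er es; split => //; lia.
Qed.

Lemma psymf_augmented_msymf k : psymf K k = augmented_msymf [:: k].
Proof. by rewrite /augmented_msymf /mult_fact /= big_seq1 /= eqxx scale1r. Qed.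

Lemma sf_fun_psymf k n : (0 < k)%N -> sf_fun (psymf K k) n = powsum K k [set: 'I_n].
Proof.
move=> k0; rewrite psymf_augmented_msymf sf_fun_augmented_msymf /posseq /= ?k0 //.
by apply: eq_bigr => j _; rewrite mulr1.
Qed.

Lemma sf_fun_sum n J (r : seq J) (P : pred J) (F : J -> symfun K) :
  sf_fun (\sum_(i <- r | P i) F i) n = \sum_(i <- r | P i) sf_fun (F i) n.
Proof. exact: (big_morph (fun f => sf_fun f n)). Qed.

Lemma psymf_mul_augmented_msymf k s : (0 < k)%N -> posseq s ->
  psymf K k * augmented_msymf s =
  augmented_msymf (k :: s) + \sum_(t <- bumps k s) augmented_msymf t.
Proof.
move=> k0 s0; apply: symfun_eq => n.
transitivity (sf_fun (psymf K k) n * sf_fun (augmented_msymf s) n); first by [].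
transitivity (sf_fun (augmented_msymf (k :: s)) n
  + sf_fun (\sum_(t <- bumps k s) augmented_msymf t) n); last by [].
have ks0 : posseq (k :: s) by rewrite /posseq /= k0.
rewrite sf_fun_sum sf_fun_psymf // !sf_fun_augmented_msymf //.
rewrite powsum_injsum; congr (_ + _); apply: eq_big_seq => t /(posseq_bumps s0)[t0 _ _].
by rewrite sf_fun_augmented_msymf.
Qed.

Definition signed_psymf k : symfun K := (-1) ^+ k.-1 *: psymf K k.

(** The sign of F turns the product rule into a difference, because adjoining k
    changes sum minus length by k-1, and increasing an entry changes it by k. *)
Lemma signed_psymf_Ftilde k s : (0 < k)%N -> posseq s ->
  signed_psymf k * Ftilde K s = Ftilde K (k :: s) - \sum_(t <- bumps k s) Ftilde K t.
Proof.
move=> k0 s0; have ls := size_leq_sumn s0.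
rewrite !FtildeE -scalerAl -scalerAr psymf_mul_augmented_msymf // scalerA -exprD scalerDr /=.
congr (_ *: _ + _); first by congr (_ ^+ _); lia.
rewrite scaler_sumr -sumrN; apply: eq_big_seq => t /(posseq_bumps s0)[t0 et es].
rewrite FtildeE et es -scaleNr; congr (_ *: _).
have -> : (sumn s + k - size s = (k.-1 + (sumn s - size s)).+1)%N by lia.
by rewrite exprS mulN1r opprK.
Qed.

Lemma sum_nat_leq a n : (a <= n)%N -> (\sum_(1 <= k < n.+1) (k <= a) = a)%N.
Proof.
elim: n a => [|n IHn] a an; first by rewrite big_geq //; lia.
rewrite big_nat_recr //=; case: (leqP a n) => h; first by rewrite IHn //; lia.
have -> : a = n.+1 by lia.
rewrite addn1 -[in RHS](IHn n) //; congr _.+1.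
by apply: eq_big_nat => k; lia.
Qed.

(** In the product of p_k and h_(n-k), a monomial of degree n occurs once for each
    variable of exponent at least k; summing over k gives its degree. *)
Lemma newton_identity n :
  \sum_(1 <= k < n.+1) psymf K k * hsymf K (n - k) = n%:R *: hsymf K n.
Proof.
apply: symfun_eq => N; rewrite sf_fun_sum; apply/mpolyP => m.
rewrite raddf_sum [RHS]mcoeffZ [in RHS]mcoeff_monosum andbT.
transitivity (\sum_(1 <= k < n.+1) \sum_(j < N) ((mdeg m == n) * (k <= m j))%:R : K).
  apply: eq_big_nat => k /andP[k0 kn].
  rewrite -[sf_fun _ _]/(sf_fun (psymf K k) N * monosum K (n - k) predT N).
  rewrite sf_fun_psymf // /powsum mulr_suml raddf_sum /=.
  apply: eq_big => [j|j _]; first by rewrite inE.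
  rewrite mcoeff_XnM; case: leqP => km; last by rewrite muln0.
  rewrite mcoeff_monosum andbT muln1; congr (nat_of_bool _)%:R.
  have : (mdeg m = mdeg (m - U_(j) *+ k)%MM + k)%N.
    by rewrite -[in LHS](submK (mnm_mulU_le km)) mdegD mdegMn mdeg1 mul1n.
  by move->; apply/eqP/eqP; lia.
rewrite exchange_big /=; under eq_bigr do rewrite -natr_sum -big_distrr /=.
rewrite -natr_sum -big_distrr -natrM; congr _%:R => /=.
case: eqP => [mn|_]; rewrite ?mul0n ?muln0 // mul1n muln1 -mn mdegE.
apply: eq_bigr => j _.
have mj : (m j <= n)%N by rewrite -mn mdegE (bigD1 j) //= leq_addr.
by rewrite -mdegE mn sum_nat_leq.
Qed.

End SymmetricFunctions.

(** * The plethystic shift is well defined *)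
Section MmapComp.
Variables (K : comNzRingType).

Lemma mmap_rmorph n (S S' : comNzRingType) (f : {rmorphism K -> S})
    (phi : {rmorphism S -> S'}) (h : 'I_n -> S) (g : {mpoly K[n]}) :
  phi (mmap f h g) = mmap (phi \o f) (phi \o h) g.
Proof.
rewrite /mmap raddf_sum /=; apply: eq_bigr => m _; rewrite rmorphM /=; congr (_ * _).
by rewrite /mmap1 rmorph_prod; apply: eq_bigr => i _; rewrite rmorphXn.
Qed.

(** Needed to write two expressions in power sums with the same number of
    variables. *)
Lemma mmap_widen n N (leN : (n <= N)%N) (S : comNzRingType) (f : {rmorphism K -> S})
    (h : nat -> S) (g : {mpoly K[n]}) :
  mmap f (fun i : 'I_N => h i)
    (mmap (@mpolyC N K) (fun i : 'I_n => 'X_(widen_ord leN i)) g) =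
  mmap f (fun i : 'I_n => h i) g.
Proof.
rewrite (mmap_rmorph (@mpolyC N K) (mmap f (fun i : 'I_N => h i))).
rewrite /mmap; apply: eq_bigr => m _; rewrite /= mmapC; congr (_ * _).
by rewrite /mmap1; apply: eq_bigr => i _; rewrite /= mmapX mmap1U.
Qed.

End MmapComp.

Section ShiftRelation.
Variables (K : fieldType) (q : K).

Definition shift_gen (k : nat) : {poly symfun K} :=
  (psymf K k)%:P - (1 - q ^- k)%:A *: 'X^k.

(** The graph of the substitution morphism. Since any expression of f in power
    sums may be used, closure under ring operations is immediate; that it is the
    graph of a function is shift_rel_fun below. *)
Definition shift_rel (f : symfun K) (P : {poly symfun K}) : Prop :=
  exists N (g : {mpoly K[N]}),
    mmap (in_alg (symfun K)) (fun i : 'I_N => psymf K i.+1) g = f /\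
    mmap (polyC \o in_alg (symfun K)) (fun i : 'I_N => shift_gen i.+1) g = P.

Lemma shift_rel_widen f P : shift_rel f P -> exists n, forall N, (n <= N)%N ->
  exists g : {mpoly K[N]},
    mmap (in_alg (symfun K)) (fun i : 'I_N => psymf K i.+1) g = f /\
    mmap (polyC \o in_alg (symfun K)) (fun i : 'I_N => shift_gen i.+1) g = P.
Proof.
case=> n [g [ef eP]]; exists n => N leN.
exists (mmap (@mpolyC N K) (fun i : 'I_n => 'X_(widen_ord leN i)) g).
by rewrite (mmap_widen leN _ (fun i => psymf K i.+1))
           (mmap_widen leN _ (fun i => shift_gen i.+1)).
Qed.

Lemma shift_rel_common f1 P1 f2 P2 : shift_rel f1 P1 -> shift_rel f2 P2 ->
  exists N (g1 g2 : {mpoly K[N]}),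
  [/\ mmap (in_alg (symfun K)) (fun i : 'I_N => psymf K i.+1) g1 = f1,
      mmap (polyC \o in_alg (symfun K)) (fun i : 'I_N => shift_gen i.+1) g1 = P1,
      mmap (in_alg (symfun K)) (fun i : 'I_N => psymf K i.+1) g2 = f2 &
      mmap (polyC \o in_alg (symfun K)) (fun i : 'I_N => shift_gen i.+1) g2 = P2].
Proof.
move=> /shift_rel_widen[n1 H1] /shift_rel_widen[n2 H2].
have [g1 [? ?]] := H1 (maxn n1 n2) (leq_maxl _ _).
have [g2 [? ?]] := H2 (maxn n1 n2) (leq_maxr _ _).
by exists (maxn n1 n2), g1, g2.
Qed.

Lemma shift_relD f1 P1 f2 P2 : shift_rel f1 P1 -> shift_rel f2 P2 ->
  shift_rel (f1 + f2) (P1 + P2).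
Proof.
move=> h1 h2; have [N [g1 [g2 [<- <- <- <-]]]] := shift_rel_common h1 h2.
by exists N, (g1 + g2); rewrite !mmapD.
Qed.

Lemma shift_relM f1 P1 f2 P2 : shift_rel f1 P1 -> shift_rel f2 P2 ->
  shift_rel (f1 * f2) (P1 * P2).
Proof.
move=> h1 h2; have [N [g1 [g2 [<- <- <- <-]]]] := shift_rel_common h1 h2.
by exists N, (g1 * g2); rewrite !rmorphM.
Qed.

Lemma shift_relC c : shift_rel c%:A (c%:A)%:P.
Proof. by exists 0%N, c%:MP; rewrite !mmapC. Qed.

Lemma shift_rel1 : shift_rel 1 1.
Proof. by have := shift_relC 1; rewrite scale1r. Qed.

Lemma shift_relZ c f P : shift_rel f P -> shift_rel (c *: f) (c%:A *: P).
Proof.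
by move=> /(shift_relM (shift_relC c)); rewrite mul_polyC mulr_algl.
Qed.

Lemma shift_relN f P : shift_rel f P -> shift_rel (- f) (- P).
Proof. by move/(shift_relZ (-1)); rewrite !scaleN1r. Qed.

Lemma shift_rel0 : shift_rel 0 0.
Proof. by have := shift_relC 0; rewrite scale0r polyC0. Qed.

Lemma shift_rel_sum (J : eqType) (r : seq J) (P : pred J) (f : J -> symfun K)
    (F : J -> {poly symfun K}) :
  (forall i, i \in r -> P i -> shift_rel (f i) (F i)) ->
  shift_rel (\sum_(i <- r | P i) f i) (\sum_(i <- r | P i) F i).
Proof.
elim: r => [|i r IH] H; first by rewrite !big_nil; exact: shift_rel0.
have /IH h : forall j, j \in r -> P j -> shift_rel (f j) (F j).
  by move=> j jr; apply: H; rewrite inE jr orbT.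
rewrite !big_cons; case Pi: (P i) => //; apply: shift_relD h.
by apply: H => //; rewrite mem_head.
Qed.

Lemma shift_rel_psymf k : (0 < k)%N -> shift_rel (psymf K k) (shift_gen k).
Proof.
case: k => // k _; exists k.+1, 'X_ord_max.
by rewrite !mmapX !mmap1U.
Qed.

Definition sfeval n (f : symfun K) : {mpoly K[n]} := sf_fun f n.

Lemma sfeval_additive n : additive (sfeval n).
Proof. by []. Qed.
HB.instance Definition _ n :=
  GRing.isAdditive.Build (symfun K) {mpoly K[n]} (sfeval n) (@sfeval_additive n).
Lemma sfeval_multiplicative n : multiplicative (sfeval n).
Proof. by []. Qed.
HB.instance Definition _ n :=
  GRing.isMultiplicative.Build (symfun K) {mpoly K[n]}
    (sfeval n) (@sfeval_multiplicative n).

Hypothesis char0 : [pchar K] =i pred0.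

Definition scal n : {rmorphism K -> {poly {mpoly K[n]}}} :=
  polyC \o @mpolyC n K.

Lemma natr_inj_rmorph (S : nzRingType) (f : {rmorphism K -> S}) :
  injective (fun m : nat => m%:R : S).
Proof.
move=> a b; rewrite -!(rmorph_nat f) => /fmorph_inj e.
wlog ab : a b e / (a <= b)%N.
  by move=> H; case/orP: (leq_total a b) => h; [exact: H|apply/esym/H].
move: e => /esym/eqP; rewrite -subr_eq0 -natrB //.
rewrite ((pcharf0P K).1 char0) subn_eq0 => ba; apply/eqP; rewrite eqn_leq ab; exact: ba.
Qed.

Lemma poly_eq0_nat n (G : {poly {poly {mpoly K[n]}}}) :
  (forall m, G.[m%:R] = 0) -> G = 0.
Proof.
move=> H; apply/eqP/negPn/negP => G0.
pose rs := [seq m%:R : {poly {mpoly K[n]}} | m <- iota 0 (size G)].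
have := @max_poly_roots _ G rs G0.
rewrite size_map size_iota ltnn; suff [-> ->] : all (root G) rs /\ uniq rs by move/(_ isT isT).
split; first by apply/allP => x /mapP[m _ ->]; rewrite rootE H.
rewrite map_inj_uniq ?iota_uniq //; exact: (natr_inj_rmorph (scal n)).
Qed.

(** The last m+1 variables are replaced by u/q, u, ..., u, where u is the
    polynomial variable; this is the evaluation at X + u/q + m u. *)
Definition subst_tail n m : 'I_(n + m.+1) -> {poly {mpoly K[n]}} := fun i =>
  match split i with
  | inl j => ('X_j)%:P
  | inr j => if j == ord0 then scal n q^-1 * 'X else 'X
  end.

Lemma subst_powsum n m k :
  mmap (scal n) (@subst_tail n m) (powsum K k [set: 'I_(n + m.+1)]) =
  (powsum K k [set: 'I_n])%:P + scal n (q ^- k) * 'X^k + m%:R * 'X^k.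
Proof.
rewrite /powsum (eq_bigl predT) => [|i]; last by rewrite inE.
rewrite [\sum_(j in _) _](eq_bigl predT) => [|i]; last by rewrite inE.
rewrite raddf_sum /= big_split_ord /= -addrA; congr (_ + _).
  rewrite raddf_sum; apply: eq_bigr => i _.
  rewrite rmorphXn /= mmapX mmap1U /subst_tail.
  by rewrite (unsplitK (inl i)) rmorphXn.
rewrite big_ord_recl; congr (_ + _).
  rewrite rmorphXn /= mmapX mmap1U /subst_tail (unsplitK (inr ord0)) /=.
  by rewrite exprMn -exprVn -!rmorphXn.
rewrite (eq_bigr (fun=> 'X^k)) => [|i _]; first by rewrite sumr_const card_ord mulr_natl.
rewrite rmorphXn /= mmapX mmap1U /subst_tail (unsplitK (inr (lift ord0 i))) /=.
by [].
Qed.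

(** Vanishing is checked in each finite number n of variables. The polynomial G
    in an indeterminate M over {poly {mpoly K[n]}} is g with p_k replaced by
    p_k + (u/q)^k + M u^k. At a natural number M = m it is g evaluated at the
    power sums of n+m+1 variables, hence 0; the shift is its value at M = -1. *)
Lemma shift_rel_zero P : shift_rel 0 P -> P = 0.
Proof.
case=> N [g [g0 <-]].
suff H n : map_poly (sfeval n)
   (mmap (polyC \o in_alg (symfun K)) (fun i : 'I_N => shift_gen i.+1) g) = 0.
  apply/polyP => i; rewrite coef0; apply: symfun_eq => n.
  by have /polyP/(_ i) := H n; rewrite coef_map coef0.
pose hG (i : 'I_N) : {poly {poly {mpoly K[n]}}} :=
  ((powsum K i.+1 [set: 'I_n])%:P + scal n (q ^- i.+1) * 'X^(i.+1))%:P
  + ('X^(i.+1))%:P * 'X.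
pose G := mmap (polyC \o scal n) hG g.
have GE (r : {poly {mpoly K[n]}}) : G.[r] =
  mmap (scal n) (fun i : 'I_N => (powsum K i.+1 [set: 'I_n])%:P
    + scal n (q ^- i.+1) * 'X^(i.+1) + r * 'X^(i.+1)) g.
  rewrite -[LHS]/(horner_eval r G) /G mmap_rmorph /mmap.
  apply: eq_bigr => mm _; congr (_ * _); first by rewrite /= /horner_eval hornerC.
  rewrite /mmap1; apply: eq_bigr => i _; congr (_ ^+ _).
  rewrite /= /horner_eval /hG hornerD hornerM !hornerC hornerX.
  by congr (_ + _); exact: mulrC.
have G0 : G = 0.
  apply: poly_eq0_nat => m; rewrite GE.
  have <- : mmap (scal n) (@subst_tail n m) (sfeval (n + m.+1)
      (mmap (in_alg (symfun K)) (fun i : 'I_N => psymf K i.+1) g)) = 0.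
    by rewrite g0 !rmorph0.
  rewrite !mmap_rmorph /mmap.
  apply: eq_bigr => mm _; congr (_ * _).
    rewrite /= -[X in mmap _ _ X]mul_mpolyC mulr1.
    exact: (esym (mmapC (@subst_tail n m) (scal n) _)).
  rewrite /mmap1; apply: eq_bigr => i _; congr (_ ^+ _).
  rewrite -[RHS]/(mmap (scal n) (@subst_tail n m) (sf_fun (psymf K i.+1) (n + m.+1))).
  by rewrite sf_fun_psymf // subst_powsum.
have := GE (-1); rewrite G0 horner0 => ->.
rewrite mmap_rmorph /mmap; apply: eq_bigr => mm _; congr (_ * _).
  by rewrite /= map_polyC; congr polyC; exact: alg_mpolyC.
rewrite /mmap1; apply: eq_bigr => i _; congr (_ ^+ _).
rewrite -[LHS]/(map_poly (sfeval n) (shift_gen i.+1)) rmorphB /=.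
rewrite -mul_polyC rmorphM /= !map_polyC map_polyXn.
transitivity ((sf_fun (psymf K i.+1) n)%:P
  - ((1 - q ^- i.+1)%:A : {mpoly K[n]})%:P * 'X^(i.+1)); first by [].
by rewrite sf_fun_psymf // alg_mpolyC mpolyCB polyCB !rmorph1 /=; ring.
Qed.

Lemma shift_rel_fun f P1 P2 : shift_rel f P1 -> shift_rel f P2 -> P1 = P2.
Proof.
move=> h1 /shift_relN h2; apply/eqP; rewrite -subr_eq0; apply/eqP.
by apply: shift_rel_zero; rewrite -(subrr f); exact: shift_relD.
Qed.

(** Only existence of one expression of f in power sums matters here; the chosen
    expression gives the same shift by shift_rel_fun. *)
Lemma pleth_shiftE f P : shift_rel f P -> pleth_shift q f = P.
Proof.
move=> h; apply: shift_rel_fun (h).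
have ex : exists g, is_pexpr f g.
  by case: h => N [g [e _]]; exists (Tagged (fun N => {mpoly K[N]}) g).
exists (tag (pexpr f)), (tagged (pexpr f)); split; last by [].
rewrite /pexpr; case: pselect => // H.
exact: (projT2 (cid H)).
Qed.

End ShiftRelation.

(** * The action of the operators *)
Section Lvalues.
Variables (I : finType) (v : I -> nat).
Implicit Types (A T U V W : {set I}).

Lemma lvalues0 : lvalues v set0 = [::].
Proof. by rewrite /lvalues /image_mem enum_set0. Qed.

Lemma perm_lvaluesD1 A x : x \in A ->
  perm_eq (lvalues v A) (v x :: lvalues v (A :\ x)).
Proof.
move=> xA; rewrite /lvalues -[v x :: _]/[seq v y | y <- x :: enum (A :\ x)].
apply/perm_map/uniq_perm; rewrite ?enum_uniq //= ?mem_enum ?inE ?eqxx ?enum_uniq //.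
by move=> y; rewrite inE !mem_enum !inE; case: eqP => [->|].
Qed.

Lemma posseq_lvalues A : (forall x, x \in A -> (0 < v x)%N) -> posseq (lvalues v A).
Proof. by move=> H; apply/allP => k /mapP[x]; rewrite mem_enum => /H h ->. Qed.

(** The form of the product rule for a labelled multiset: the increased element
    is taken out and adjoined with its new value. *)
Lemma sum_bumps_lvalues (V : nmodType) (F : seq nat -> V) k A :
  (forall s t, perm_eq s t -> F s = F t) ->
  \sum_(t <- bumps k (lvalues v A)) F t =
  \sum_(x in A) F ((v x + k)%N :: lvalues v (A :\ x)).
Proof.
move=> FP; transitivity (\sum_(x <- enum A)
    F ((v x + k)%N :: [seq v y | y <- rem x (enum A)])).
  rewrite /lvalues /image_mem; have := enum_uniq A; elim: (enum A) F FP => [|y e IH] F FP /=.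
    by rewrite !big_nil.
  case/andP=> ye ue; rewrite !big_cons big_map /= eqxx; congr (_ + _).
  rewrite (IH (fun t => F (v y :: t))) => [|s t st|//]; last first.
    by apply: FP; rewrite perm_cons.
  apply: eq_big_seq => x xe; case: eqP => [yx|_]; first by rewrite yx xe in ye.
  apply: FP; rewrite /= -[_ :: _ :: _]/([:: v y; (v x + k)%N] ++ _).
  by rewrite -[X in perm_eq _ X]/([:: (v x + k)%N; v y] ++ _) perm_cat2r (perm_catC [:: v y]).
rewrite big_enum; apply: eq_bigr => x xA; apply: FP; rewrite perm_cons.
apply/perm_map/uniq_perm; rewrite ?rem_uniq ?enum_uniq //.
by move=> y; rewrite mem_rem_uniq ?enum_uniq // !inE !mem_enum !inE.
Qed.

End Lvalues.

Section Coefficients.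
Variables (K : comNzRingType) (q : K) (I : finType) (v : I -> nat).
Implicit Types (A T U V W : {set I}).

(** The coefficient of H_(a+S_T) F_(A - T) in C_a(F_A), the case of an empty T
    included. *)
Definition detach_coef T : K := (T == set0)%:R - detach_weight q v T.

(** The coefficient for removing T together with an adjoined element b, that is
    minus the weight of T + b, written in terms of the weight of T. *)
Definition detach_cons_coef b T : K :=
  - (#|T|`!%:R * q ^+ lsum v T * (1 - q ^+ b) + #|T|%:R * q ^+ b * detach_weight q v T).

Lemma detach_weight_setU1 a T : a \notin T ->
  detach_weight q v (a |: T) = - detach_cons_coef (v a) T.
Proof.
move=> aT; rewrite /detach_cons_coef opprK /detach_weight lsumU1 // cardsU1 aT add1n big_setU1 //= addKn.
have -> : \sum_(x in T) (q ^+ (v a + lsum v T - v x) - q ^+ (v a + lsum v T)) =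
    q ^+ v a * \sum_(x in T) (q ^+ (lsum v T - v x) - q ^+ lsum v T).
  rewrite mulr_sumr; apply: eq_bigr => x xT.
  by rewrite -addnBA ?leq_lsum // !exprD mulrBr.
case: (posnP #|T|) => [/eqP|t0].
  by rewrite cards_eq0 => /eqP->; rewrite cards0 big_set0 lsum0 addn0 fact0; ring.
rewrite exprD; set s := \sum_(x in T) _.
by case: #|T| t0 => // n _; rewrite /= !factS !natrM; ring.
Qed.

Lemma detach_coef_setU1 a T : a \notin T ->
  detach_coef (a |: T) = detach_cons_coef (v a) T.
Proof.
move=> aT; rewrite /detach_coef detach_weight_setU1 // opprK.
have -> : (a |: T == set0) = false.
  by apply/negbTE/set0Pn; exists a; rewrite setU11.
by rewrite add0r.
Qed.

(** The recursion that the product rule imposes on the coefficients: the part b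
    contributes its own shift, or it has been added to an element x of T. *)
Lemma detach_cons_coef_rec b T :
  detach_cons_coef b T = - (1 - q ^+ b) * detach_coef T
    + \sum_(x in T) detach_cons_coef (v x + b) (T :\ x).
Proof.
have [->|T0] := eqVneq T set0.
  by rewrite /detach_coef /detach_cons_coef detach_weight0 big_set0 cards0 lsum0 eqxx fact0 /=; ring.
rewrite /detach_coef (negbTE T0).
have t0 : (0 < #|T|)%N by rewrite card_gt0.
have E x : x \in T -> detach_cons_coef (v x + b) (T :\ x) =
   - ((#|T|.-1)`!%:R * (q ^+ (lsum v T - v x) - q ^+ lsum v T * q ^+ b)
     + q ^+ b * ((#|T|.-1)`!%:R * \sum_(y in T :\ x) (q ^+ (lsum v T - v y) - q ^+ lsum v T))).
  move=> xT; rewrite /detach_cons_coef /detach_weight.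
  have cT : #|T :\ x| = #|T|.-1 by rewrite (cardsD1 x T) xT.
  have lT := lsumD1 v xT.
  have -> : \sum_(y in T :\ x) (q ^+ (lsum v T - v y) - q ^+ lsum v T) =
     q ^+ v x * \sum_(y in T :\ x) (q ^+ (lsum v (T :\ x) - v y) - q ^+ lsum v (T :\ x)).
    rewrite mulr_sumr; apply: eq_bigr => y yT.
    by rewrite lT -addnBA ?leq_lsum // !exprD mulrBr.
  rewrite cT lT addKn !exprD; set s := \sum_(y in _) _.
  case e: #|T|.-1 => [|n]; last by rewrite /= factS natrM; ring.
  have -> : s = 0.
    apply: big1 => y; move: cT; rewrite e => /eqP; rewrite cards_eq0 => /eqP->.
    by rewrite inE.
  by ring.
rewrite (eq_bigr _ E) sumrN big_split /= -mulr_sumr -mulr_sumr -mulr_sumr.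
have -> : \sum_(x in T) \sum_(y in T :\ x) (q ^+ (lsum v T - v y) - q ^+ lsum v T) =
   (#|T|.-1)%:R * \sum_(y in T) (q ^+ (lsum v T - v y) - q ^+ lsum v T).
  rewrite (exchange_big_dep (mem T)) /=; last by move=> x y _ /setD1P[].
  rewrite mulr_sumr; apply: eq_bigr => y yT.
  rewrite (eq_bigl (mem (T :\ y))) => [|x]; last by rewrite !inE yT andbT eq_sym andbC.
  by rewrite sumr_const mulr_natl (cardsD1 y T) yT.
rewrite /detach_cons_coef /detach_weight !sumrB !sumr_const.
rewrite -[(_ * _) *+ _]mulr_natl -[q ^+ _ *+ _]mulr_natl.
by case: #|T| t0 => // n _; rewrite /= factS natrM -natr1; ring.
Qed.

End Coefficients.

Section ShiftFtilde.
Variables (K : fieldType) (q : K) (I : finType) (v : I -> nat).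
Hypothesis char0 : [pchar K] =i pred0.
Hypothesis q0 : q != 0.
Implicit Types (A T U V W : {set I}).

Local Notation F := (Ftilde K).

(** The variable is 1/z divided by -q. In this scale the shift of F_A has the
    coefficients detach_coef, and C_a turns its n-th power into H_(a+n). *)
Definition shift_var : {poly symfun K} := (- q^-1)%:A *: 'X.
Local Notation w := shift_var.

Lemma shift_rel_signed_psymf b : (0 < b)%N ->
  shift_rel q (signed_psymf K b) ((signed_psymf K b)%:P - (1 - q ^+ b)%:A *: w ^+ b).
Proof.
move=> b0; have := shift_relZ ((-1) ^+ b.-1) (shift_rel_psymf q b0).
congr shift_rel; rewrite /shift_gen /shift_var exprZn scalerBr !scalerA; congr (_ - _ *: _).
  by rewrite -!mul_polyC -polyCM mulr_algl.
rewrite -[LHS](rmorphM (in_alg (symfun K))) -[_%:A ^+ b](rmorphXn (in_alg (symfun K))).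
rewrite -[RHS](rmorphM (in_alg (symfun K))) /=; congr _%:A.
case: b b0 => // b _; rewrite (exprNn q^-1) exprVn [b.+1.-1]/= mulrCA [(_ - _) * _]mulrBl mul1r mulfV ?expf_neq0 //.
by rewrite [(-1) ^+ b.+1]exprS -mulrA mulN1r -mulrN opprB.
Qed.

Definition shift_lvalues A : {poly symfun K} :=
  \sum_(T : {set I} | T \subset A)
    (detach_coef q v T *: F (lvalues v (A :\: T))) *: w ^+ lsum v T.

Definition shift_cons b A : {poly symfun K} :=
  \sum_(T : {set I} | T \subset A)
    (detach_coef q v T *: F (b :: lvalues v (A :\: T))) *: w ^+ lsum v T
  + \sum_(T : {set I} | T \subset A)
    (detach_cons_coef q v b T *: F (lvalues v (A :\: T))) *: w ^+ (lsum v T + b).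

Lemma shift_lvalues_cons A a : a \in A ->
  shift_lvalues A = shift_cons (v a) (A :\ a).
Proof.
move=> aA; rewrite /shift_lvalues (sum_subset_split _ aA); congr (_ + _).
  apply: eq_bigr => T; rewrite subsetD1 => /andP[sT aT].
  rewrite (@perm_Ftilde _ (lvalues v (A :\: T)) (v a :: lvalues v (A :\ a :\: T))) //.
  by rewrite setDDl setUC -setDDl perm_lvaluesD1 // inE aT.
apply: eq_bigr => T; rewrite subsetD1 => /andP[sT aT].
by rewrite detach_coef_setU1 // lsumU1 // addnC setDDl.
Qed.

(** The shifted product rule. The terms in which b is added to an element that
    stays in the multiset cancel against those coming from the product with
    F_(A - T); those in which it is added to an element of T combine by
    detach_cons_coef_rec. *)
Lemma shift_cons_rec b A : (0 < b)%N -> (forall x, x \in A -> (0 < v x)%N) ->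
  shift_cons b A =
  ((signed_psymf K b)%:P - (1 - q ^+ b)%:A *: w ^+ b) * shift_lvalues A
  + \sum_(x in A) shift_cons (v x + b) (A :\ x).
Proof.
move=> b0 v0.
have E1 : (signed_psymf K b)%:P * shift_lvalues A =
  \sum_(T : {set I} | T \subset A)
    (detach_coef q v T *: F (b :: lvalues v (A :\: T))) *: w ^+ lsum v T
  - \sum_(T : {set I} | T \subset A) \sum_(x in A :\: T)
     (detach_coef q v T *: F ((v x + b)%N :: lvalues v (A :\: T :\ x))) *: w ^+ lsum v T.
  rewrite mulr_sumr -sumrB; apply: eq_bigr => T sT.
  rewrite mul_polyC scalerA -scalerAr signed_psymf_Ftilde //; last first.
    by apply: posseq_lvalues => x /setDP[xA _]; exact: v0.
  rewrite sum_bumps_lvalues; last exact: perm_Ftilde.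
  by rewrite scalerBr scalerBl scaler_sumr scaler_suml.
have E2 : (1 - q ^+ b)%:A *: w ^+ b * shift_lvalues A =
  \sum_(T : {set I} | T \subset A)
    (((1 - q ^+ b) * detach_coef q v T) *: F (lvalues v (A :\: T))) *: w ^+ (lsum v T + b).
  rewrite mulr_sumr; apply: eq_bigr => T sT.
  by rewrite -scalerAl -scalerAr scalerA -exprD addnC mulr_algl scalerA.
rewrite mulrBl E1 E2 /shift_cons big_split /=.
have -> : \sum_(x in A) \sum_(T : {set I} | T \subset A :\ x)
    (detach_coef q v T *: F ((v x + b)%N :: lvalues v (A :\ x :\: T))) *: w ^+ lsum v T =
  \sum_(T : {set I} | T \subset A) \sum_(x in A :\: T)
     (detach_coef q v T *: F ((v x + b)%N :: lvalues v (A :\: T :\ x))) *: w ^+ lsum v T.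
  rewrite [RHS](exchange_big_dep (mem A)) /=; last by move=> T x _ /setDP[].
  apply: eq_bigr => x xA; apply: eq_big => [T|T _]; last by rewrite setDDl setUC -setDDl.
  by rewrite subsetD1 inE xA andbT.
have -> : \sum_(x in A) \sum_(T : {set I} | T \subset A :\ x)
    (detach_cons_coef q v (v x + b) T *: F (lvalues v (A :\ x :\: T)))
      *: w ^+ (lsum v T + (v x + b)) =
  \sum_(T : {set I} | T \subset A)
    ((\sum_(x in T) detach_cons_coef q v (v x + b) (T :\ x)) *: F (lvalues v (A :\: T)))
      *: w ^+ (lsum v T + b).
  under [RHS]eq_bigr do rewrite scaler_suml scaler_suml.
  rewrite (exchange_sum_subset_mem A (fun x T => (detach_cons_coef q v (v x + b) (T :\ x)
    *: F (lvalues v (A :\: T))) *: w ^+ (lsum v T + b))).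
  apply: eq_bigr => x xA; apply: eq_bigr => T; rewrite subsetD1 => /andP[sT xT].
  by rewrite setU1K // lsumU1 // setDDl addnCA addnA.
have -> : \sum_(T : {set I} | T \subset A)
    (detach_cons_coef q v b T *: F (lvalues v (A :\: T))) *: w ^+ (lsum v T + b) =
  - (\sum_(T : {set I} | T \subset A)
    (((1 - q ^+ b) * detach_coef q v T) *: F (lvalues v (A :\: T))) *: w ^+ (lsum v T + b))
  + \sum_(T : {set I} | T \subset A)
    ((\sum_(x in T) detach_cons_coef q v (v x + b) (T :\ x)) *: F (lvalues v (A :\: T)))
      *: w ^+ (lsum v T + b).
  rewrite -sumrN -big_split /=; apply: eq_bigr => T sT.
  by rewrite -scaleNr -scalerDl -scaleNr -scalerDl detach_cons_coef_rec mulNr.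
by rewrite addrACA addrA subrK -addrA.
Qed.

(** Induction on the size of A. For the multiset A itself one element is viewed
    as adjoined to the rest; for an adjoined b the product rule expresses
    F_(A + b) through F_A and smaller multisets with an adjoined element. *)
Lemma shift_rel_lvalues A : (forall x, x \in A -> (0 < v x)%N) ->
  shift_rel q (F (lvalues v A)) (shift_lvalues A) /\
  forall b, (0 < b)%N -> shift_rel q (F (b :: lvalues v A)) (shift_cons b A).
Proof.
have [n] := ubnP #|A|; elim: n A => // n IHn A; rewrite ltnS => An v0.
have v0D x y : y \in A :\ x -> (0 < v y)%N by move=> /setD1P[_ /v0].
have cA x : x \in A -> (#|A :\ x| < n)%N.
  by move=> xA; apply: leq_trans An; rewrite [X in (_ < X)%N](cardsD1 x) xA.
have h0 : shift_rel q (F (lvalues v A)) (shift_lvalues A).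
  have [->|/set0Pn[a aA]] := eqVneq A set0.
    rewrite lvalues0 Ftilde_nil /shift_lvalues; under eq_bigl do rewrite subset0.
    rewrite big_pred1_eq setD0 lvalues0 Ftilde_nil lsum0 /detach_coef detach_weight0 eqxx subr0 !scale1r.
    exact: shift_rel1.
  rewrite (shift_lvalues_cons aA) (perm_Ftilde _ (perm_lvaluesD1 v aA)).
  have [_] := IHn (A :\ a) (cA _ aA) (v0D a); apply; exact: v0.
split=> // b b0; rewrite shift_cons_rec //.
have -> : F (b :: lvalues v A) = signed_psymf K b * F (lvalues v A)
    + \sum_(x in A) F ((v x + b)%N :: lvalues v (A :\ x)).
  rewrite signed_psymf_Ftilde ?posseq_lvalues //.
  by rewrite sum_bumps_lvalues ?subrK //; exact: perm_Ftilde.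
apply: shift_relD; first by apply: shift_relM h0; exact: shift_rel_signed_psymf.
rewrite -!big_enum; apply: shift_rel_sum => x; rewrite mem_enum => xA _.
have [_] := IHn _ (cA _ xA) (v0D x); apply; by rewrite addn_gt0 b0 orbT.
Qed.

(** This is C_n(1) for positive n. *)
Definition hnorm (n : nat) : symfun K := (- q^-1) ^+ n.-1 *: hsymf K n.

(** The passage from the shift of f to C_a(f), as an additive function of the
    shift. *)
Definition coef_extract a (P : {poly symfun K}) : symfun K :=
  (- q^-1) ^+ a.-1 *: \sum_(i < size P) P`_i * hsymf K (a + i).

Lemma coef_extractE a (P : {poly symfun K}) N : (size P <= N)%N ->
  coef_extract a P = (- q^-1) ^+ a.-1 *: \sum_(i < N) P`_i * hsymf K (a + i).
Proof.
move=> PN; congr (_ *: _); rewrite (big_ord_widen N (fun i => P`_i * hsymf K (a + i))) //.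
rewrite big_mkcond; apply: eq_bigr => i _; case: ltnP => // h.
by rewrite nth_default // mul0r.
Qed.

Lemma coef_extract_sum a (J : finType) (P : pred J) (f : J -> {poly symfun K}) :
  coef_extract a (\sum_(j | P j) f j) = \sum_(j | P j) coef_extract a (f j).
Proof.
pose N := (\max_(j | P j) size (f j))%N.
rewrite (@coef_extractE a _ N); last exact: size_sum.
transitivity (\sum_(j | P j) (- q^-1) ^+ a.-1 *:
   \sum_(i < N) (f j)`_i * hsymf K (a + i)).
  rewrite -scaler_sumr exchange_big /=; congr (_ *: _).
  by apply: eq_bigr => i _; rewrite coef_sum mulr_suml.
by apply: eq_bigr => j Pj; rewrite (@coef_extractE a _ N) // /N leq_bigmax_cond.
Qed.

Lemma coef_extractD a P1 P2 :
  coef_extract a (P1 + P2) = coef_extract a P1 + coef_extract a P2.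
Proof.
pose f (b : bool) := if b then P1 else P2.
have := coef_extract_sum a predT f; by rewrite !big_bool.
Qed.

Lemma coef_extract_mono a x n : (0 < a)%N ->
  coef_extract a (x *: w ^+ n) = x * hnorm (a + n).
Proof.
move=> a0; rewrite /shift_var exprZn scalerA.
rewrite (@coef_extractE a _ n.+1); last first.
  by rewrite (leq_trans (size_scale_leq _ _)) // size_polyXn.
rewrite big_ord_recr /= big1 ?add0r => [|i _]; last first.
  by rewrite coefZ coefXn ltn_eqF // mulr0 mul0r.
rewrite coefZ coefXn eqxx mulr1 /hnorm -[_%:A ^+ n](rmorphXn (in_alg (symfun K))).
rewrite mulr_algr -scalerAl -scalerAr !scalerA -exprD; congr (_ ^+ _ *: _).
by case: a a0.
Qed.

Lemma Cop_lvalues a A : (0 < a)%N -> (forall x, x \in A -> (0 < v x)%N) ->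
  Cop q a (F (lvalues v A)) =
  \sum_(T : {set I} | T \subset A)
    detach_coef q v T *: (hnorm (a + lsum v T) * F (lvalues v (A :\: T))).
Proof.
move=> a0 v0; have [h _] := shift_rel_lvalues v0.
rewrite /Cop (pleth_shiftE char0 h) -/(coef_extract a _) coef_extract_sum.
by apply: eq_bigr => T _; rewrite coef_extract_mono // -scalerAl mulrC.
Qed.

Lemma Cop_cons a b A : (0 < a)%N -> (0 < b)%N -> (forall x, x \in A -> (0 < v x)%N) ->
  Cop q a (F (b :: lvalues v A)) =
  \sum_(T : {set I} | T \subset A)
    detach_coef q v T *: (hnorm (a + lsum v T) * F (b :: lvalues v (A :\: T)))
  + \sum_(T : {set I} | T \subset A)
    detach_cons_coef q v b T *: (hnorm (a + lsum v T + b) * F (lvalues v (A :\: T))).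
Proof.
move=> a0 b0 v0; have [_ /(_ _ b0) h] := shift_rel_lvalues v0.
rewrite /Cop (pleth_shiftE char0 h) -/(coef_extract a _) coef_extractD !coef_extract_sum.
congr (_ + _); apply: eq_bigr => T _; rewrite coef_extract_mono // -scalerAl mulrC //.
by rewrite addnA.
Qed.

End ShiftFtilde.

(** * The sums obtained from Newton's identity *)
Section AlternatingSum.
Variables (K : fieldType) (I : finType) (v : I -> nat).
Implicit Types (A T U V W : {set I}).

Local Notation F := (Ftilde K).

(** The sign makes this q^(n-1) H_n for positive n, and -1 for n = 0. *)
Definition signed_hsymf (n : nat) : symfun K := (-1) ^+ n.+1 *: hsymf K n.

Lemma hsymf0 : hsymf K 0 = 1.
Proof.
apply: symfun_eq => n; apply/mpolyP => m.
by rewrite /= mcoeff_monosum andbT mcoeff1 mdeg_eq0.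
Qed.

Lemma signed_hsymf0 : signed_hsymf 0 = -1.
Proof. by rewrite /signed_hsymf hsymf0 expr1 scaleN1r. Qed.

Lemma newton_signed n :
  n%:R *: signed_hsymf n =
  - \sum_(1 <= k < n.+1) signed_hsymf (n - k) * signed_psymf K k.
Proof.
rewrite /signed_hsymf scalerA mulrC -scalerA -newton_identity scaler_sumr -sumrN.
apply: eq_big_nat => k /andP[k0 kn].
rewrite /signed_psymf -scalerAl -scalerAr scalerA -exprD -scaleNr mulrC.
congr (_ *: _); rewrite -[RHS]mulN1r -exprS; congr (_ ^+ _); lia.
Qed.

(** The term k = n is F_(A + n), since the factor with index 0 is -1. *)
Definition altsum n A : symfun K :=
  - \sum_(1 <= k < n.+1) signed_hsymf (n - k) * F (k :: lvalues v A).

(** Newton's identity is multiplied by F_A. When k is added to an element x, the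
    new values x+k are those above x, so that the sum is the one for A - x and
    n + x without its terms of value at most x. *)
Lemma altsum_rec n A : (forall x, x \in A -> (0 < v x)%N) ->
  altsum n A = n%:R *: (signed_hsymf n * F (lvalues v A))
  + \sum_(x in A) (altsum (n + v x) (A :\ x)
     + \sum_(1 <= b < (v x).+1) signed_hsymf (n + v x - b) * F (b :: lvalues v (A :\ x))).
Proof.
move=> v0.
have E x : x \in A -> altsum (n + v x) (A :\ x)
     + \sum_(1 <= b < (v x).+1) signed_hsymf (n + v x - b) * F (b :: lvalues v (A :\ x))
   = - \sum_(1 <= k < n.+1) signed_hsymf (n - k) * F ((v x + k)%N :: lvalues v (A :\ x)).
  move=> xA; rewrite /altsum (big_cat_nat (n := (v x).+1)) /=; [|lia|lia].
  rewrite opprD addrAC addNr add0r; congr (- _).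
  rewrite -[(v x).+1]add1n big_addn.
  have -> : ((n + v x).+1 - v x = n.+1)%N by lia.
  by apply: eq_big_nat => k /andP[k0 kn]; rewrite (addnC k) (addnC n) subnDl.
rewrite (eq_bigr _ E) sumrN exchange_big /= scalerAl newton_signed /altsum mulNr -opprD.
congr (- _); rewrite mulr_suml -big_split /=; apply: eq_big_nat => k /andP[k0 kn].
rewrite -mulr_sumr -mulrA -mulrDr signed_psymf_Ftilde ?posseq_lvalues //.
by rewrite sum_bumps_lvalues ?subrK //; exact: perm_Ftilde.
Qed.

(** Unrolling the recursion. The elements of T are removed one after the other;
    in the first sum all #|T|! orders occur, while in the second the element x
    that bounds b comes last, which leaves (#|T|-1)! orders. *)
Lemma altsumE n A : (forall x, x \in A -> (0 < v x)%N) ->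
  altsum n A =
  \sum_(T : {set I} | T \subset A)
    (#|T|`!%:R * (n + lsum v T)%:R) *: (signed_hsymf (n + lsum v T) * F (lvalues v (A :\: T)))
  + \sum_(T : {set I} | T \subset A) \sum_(x in T)
      (#|T|.-1)`!%:R *: \sum_(1 <= b < (v x).+1)
         signed_hsymf (n + lsum v T - b) * F (b :: lvalues v (A :\: T)).
Proof.
have [m] := ubnP #|A|; elim: m n A => // m IHm n A; rewrite ltnS => Am v0.
rewrite altsum_rec //.
pose Y T := signed_hsymf (n + lsum v T) * F (lvalues v (A :\: T)).
pose Z x T := \sum_(1 <= b < (v x).+1)
         signed_hsymf (n + lsum v T - b) * F (b :: lvalues v (A :\: T)).
have E x : x \in A -> altsum (n + v x) (A :\ x)
     + \sum_(1 <= b < (v x).+1) signed_hsymf (n + v x - b) * F (b :: lvalues v (A :\ x))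
   = \sum_(T : {set I} | T \subset A :\ x)
       ((#|x |: T|.-1)`!%:R * (n + lsum v (x |: T))%:R) *: Y (x |: T)
     + (\sum_(T : {set I} | T \subset A :\ x) \sum_(y in (x |: T) :\ x)
         (#|x |: T|.-2)`!%:R *: Z y (x |: T)
     + \sum_(T : {set I} | T \subset A :\ x) (#|x |: T| == 1)%:R *: Z x (x |: T)).
  move=> xA; rewrite IHm; last first.
  - by move=> y /setD1P[_ /v0].
  - by apply: leq_trans Am; rewrite [X in (_ < X)%N](cardsD1 x) xA.
  rewrite -addrA; congr (_ + (_ + _)).
  - apply: eq_bigr => T; rewrite subsetD1 => /andP[sT xT].
    by rewrite cardsU1 xT /Y lsumU1 // setDDl addnA.
  - apply: eq_bigr => T; rewrite subsetD1 => /andP[sT xT].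
    rewrite setU1K // cardsU1 xT; apply: eq_bigr => y yT; congr (_ *: _).
    by apply: eq_bigr => b _; rewrite lsumU1 // setDDl addnA.
  - rewrite (bigD1 set0) ?sub0set //= setU0 cards1 eqxx scale1r [X in _ = _ + X]big1 ?addr0.
      by rewrite /Z /lsum big_set1.
    move=> T /andP[]; rewrite subsetD1 => /andP[sT xT] T0.
    by rewrite cardsU1 xT add1n eqSS cards_eq0 (negbTE T0) scale0r.
rewrite (eq_bigr _ E) !big_split /=.
rewrite -(exchange_sum_subset_mem A (fun x T => ((#|T|.-1)`!%:R * (n + lsum v T)%:R) *: Y T)).
rewrite -(exchange_sum_subset_mem A (fun x T =>
  \sum_(y in T :\ x) (#|T|.-2)`!%:R *: Z y T)).
rewrite -(exchange_sum_subset_mem A (fun x T => (#|T| == 1)%:R *: Z x T)).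
rewrite [LHS]addrA; congr (_ + _).
  rewrite [RHS](bigD1 set0) ?sub0set //= cards0 lsum0 setD0 addn0 fact0 mul1r; congr (_ + _).
  rewrite (bigD1 set0) ?sub0set //= big_set0 add0r; apply: eq_bigr => T /andP[sT T0].
  rewrite sumr_const -scaler_nat scalerA; congr (_ *: _).
  move: T0; rewrite -cards_eq0; case: #|T| => // k _.
  by rewrite factS natrM mulrA.
rewrite -big_split /=; apply: eq_bigr => T sT.
rewrite (exchange_big_dep (mem T)) /=; last by move=> x y _ /setD1P[].
rewrite -big_split /=; apply: eq_bigr => y yT.
rewrite (eq_bigl (mem (T :\ y))) => [|x]; last by rewrite !inE yT andbT eq_sym andbC.
rewrite sumr_const -scaler_nat scalerA -scalerDl; congr (_ *: _).
have -> : #|T :\ y| = #|T|.-1 by rewrite (cardsD1 y T) yT.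
have : (0 < #|T|)%N by rewrite (cardsD1 y T) yT.
case: #|T| => // [[|k]] _ /=; first by rewrite mul0r add0r.
by rewrite addr0 factS natrM.
Qed.

End AlternatingSum.

(** * Comparison of the coefficients *)
Section QSums.
Variables (K : comNzRingType) (q : K).

Lemma sum_rev_pow m n : (0 < m <= n)%N ->
  \sum_(m <= b < n) q ^+ (m + n - b - 2) = \sum_(m.-1 <= i < n.-1) q ^+ i.
Proof.
move=> /andP[m0 mn]; rewrite big_nat_rev /=; case: m n m0 mn => // m [|n] // _ _.
rewrite big_add1 /=; apply: eq_big_nat => i ?; congr (_ ^+ _); lia.
Qed.

(** The contribution of an element of value x of T to alpha. *)
Definition alpha_term (c x b : nat) : K :=
  if (b <= x)%N then q ^+ ((c + x - b - 1) %% x) else 0.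

Lemma alpha_termE c x b : (0 < b)%N -> (0 < c <= x)%N ->
  alpha_term c x b = if (b < c)%N then q ^+ (c - b - 1)
             else if (b <= x)%N then q ^+ (c + x - b - 1) else 0.
Proof.
move=> b0 /andP[c0 cx]; rewrite /alpha_term; case: (ltnP b c) => bc.
  have -> : (b <= x)%N by lia.
  have -> : (c + x - b - 1 = c - b - 1 + x)%N by lia.
  by rewrite modnDr modn_small //; lia.
by case: leqP => // bx; rewrite modn_small //; lia.
Qed.

End QSums.

Section CoefficientIdentities.
Variables (K : fieldType) (q : K) (I : finType) (v : I -> nat) (c : nat).
Hypothesis c0 : (0 < c)%N.
Implicit Types (A T U V W : {set I}).

Lemma qintE n : qint q n = \sum_(0 <= i < n) q ^+ i.
Proof. by rewrite /qint big_mkord. Qed.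

Lemma sum_pow_lt : \sum_(1 <= b < c) q ^+ (c - b - 1) = qint q c.-1.
Proof.
rewrite qintE -(sum_rev_pow q (m := 1)) ?c0 //.
by apply: eq_big_nat => b ?; congr (_ ^+ _); lia.
Qed.

Lemma qint_pred : qint q c = qint q c.-1 + q ^+ c.-1.
Proof. by case: c c0 => // n _; rewrite /qint big_ord_recr. Qed.

Lemma sum_alpha_term_split (g : nat -> K) x N : (c <= x < N)%N ->
  \sum_(1 <= b < N) alpha_term q c x b * g b =
  \sum_(1 <= b < c) q ^+ (c - b - 1) * g b
  + \sum_(c <= b < x.+1) q ^+ (c + x - b - 1) * g b.
Proof.
case/andP=> cx xN; rewrite (big_cat_nat (n := c)) /=; [|lia|lia].
rewrite [X in _ + X](big_cat_nat (n := x.+1)) /=; [|lia|lia].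
rewrite [X in _ + (_ + X)]big1_seq ?addr0 => [|b]; last first.
  by rewrite mem_index_iota => /andP[_ h]; rewrite /alpha_term ifF ?mul0r //; lia.
congr (_ + _); apply: eq_big_nat => b ?; rewrite alpha_termE ?c0 //; try lia.
  by rewrite ifT //; lia.
by rewrite ifF ?ifT //; lia.
Qed.

(** As b runs from 1 to x, the exponent (c+x-b-1) mod x takes each of the values
    0, ..., x-1 once. *)
Lemma sum_alpha_term x N : (c <= x < N)%N ->
  \sum_(1 <= b < N) alpha_term q c x b = qint q x.
Proof.
move=> h; transitivity (\sum_(1 <= b < N) alpha_term q c x b * 1).
  by apply: eq_bigr => b _; rewrite mulr1.
rewrite (sum_alpha_term_split (fun=> 1) h).
under eq_bigr do rewrite mulr1.
under [X in _ + X]eq_bigr do rewrite mulr1.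
rewrite sum_pow_lt.
have -> : \sum_(c <= b < x.+1) q ^+ (c + x - b - 1) = \sum_(c.-1 <= i < x) q ^+ i.
  rewrite -(sum_rev_pow q (n := x.+1)); last lia.
  by apply: eq_big_nat => b ?; congr (_ ^+ _); lia.
by rewrite !qintE -big_cat_nat //=; lia.
Qed.

Lemma sum_alpha_term_pow x N : (c <= x < N)%N ->
  \sum_(1 <= b < N) alpha_term q c x b * q ^+ b =
  c.-1%:R * q ^+ c.-1 + (x.+1 - c)%:R * (q ^+ c.-1 * q ^+ x).
Proof.
move=> h; rewrite (sum_alpha_term_split _ h); congr (_ + _).
  rewrite (eq_big_nat _ _ (F2 := fun=> q ^+ c.-1)) => [|b ?].
    by rewrite sumr_const_nat subn1 mulr_natl.
  by rewrite -exprD; congr (_ ^+ _); lia.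
rewrite (eq_big_nat _ _ (F2 := fun=> q ^+ c.-1 * q ^+ x)) => [|b ?].
  by rewrite sumr_const_nat mulr_natl.
by rewrite -!exprD; congr (_ ^+ _); lia.
Qed.

Lemma alphaE T b :
  alpha q v c T b = (#|T|.-1)`!%:R * \sum_(x in T) alpha_term q c (v x) b.
Proof.
rewrite /alpha; case: eqP => [->|_]; first by rewrite big_set0 mulr0.
by rewrite big_mkcondr.
Qed.

(** The sum q^c + ... + q^(x-1) is [x] - [c], and the #|T| copies of [c] that are
    subtracted reduce the factor (#|T|+1)! of [c] to #|T|!. *)
Lemma betaE T : (forall x, x \in T -> (c <= v x)%N) ->
  beta q v c T = #|T|`!%:R * (qint q c + \sum_(x in T) qint q (v x)).
Proof.
move=> cT; rewrite /beta factS natrM -natr1.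
rewrite (eq_bigr (fun x => qint q (v x) - qint q c)) => [|x xT]; last first.
  by rewrite !qintE (big_cat_nat (m := 0) (n := c)) ?cT //= [RHS]addrC addKr.
by rewrite sumrB sumr_const -[qint q c *+ _]mulr_natl; ring.
Qed.

Lemma sum_detach_coef V (f : {set I} -> K) :
  \sum_(T : {set I} | T \subset V) f T * detach_coef q v (V :\: T) =
  f V - \sum_(T : {set I} | T \subset V) f T * detach_weight q v (V :\: T).
Proof.
rewrite /detach_coef; under eq_bigr do rewrite mulrBr.
rewrite sumrB; congr (_ - _).
rewrite (bigD1 V) //= setDv eqxx mulr1 big1 ?addr0 // => T /andP[sT TV].
case: eqP => [/eqP|]; last by rewrite mulr0.
by rewrite setD_eq0 => sV; case/negP: TV; rewrite eqEsubset sT.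
Qed.

(** For a fixed x the sum over the sets T containing x is the sum of
    sum_fact_detach for V - x. *)
Lemma alpha_detach_coef V b :
  \sum_(T : {set I} | T \subset V) alpha q v c T b * detach_coef q v (V :\: T) =
  (#|V|.-1)`!%:R * \sum_(x in V) alpha_term q c (v x) b * q ^+ (lsum v V - v x).
Proof.
rewrite (sum_detach_coef V (fun T => alpha q v c T b)).
have -> : \sum_(T : {set I} | T \subset V) alpha q v c T b * detach_weight q v (V :\: T) =
   \sum_(x in V) alpha_term q c (v x) b * ((#|V|.-1)`!%:R * (1 - q ^+ (lsum v V - v x))).
  transitivity (\sum_(T : {set I} | T \subset V) \sum_(x in T)
     alpha_term q c (v x) b * ((#|T|.-1)`!%:R * detach_weight q v (V :\: T))).
    apply: eq_bigr => T _; rewrite alphaE mulrAC mulr_sumr.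
    by apply: eq_bigr => x _; rewrite mulrC.
  rewrite (exchange_sum_subset_mem V (fun x T =>
     alpha_term q c (v x) b * ((#|T|.-1)`!%:R * detach_weight q v (V :\: T)))).
  apply: eq_bigr => x xV; rewrite -mulr_sumr; congr (_ * _).
  have -> : (lsum v V - v x = lsum v (V :\ x))%N by rewrite (lsumD1 v xV) addKn.
  have -> : (#|V|.-1 = #|V :\ x|)%N by rewrite (cardsD1 x V) xV.
  rewrite -sum_fact_detach; apply: eq_bigr => T; rewrite subsetD1 => /andP[_ xT].
  by rewrite cardsU1 xT setDDl.
rewrite alphaE !mulr_sumr -sumrB; apply: eq_bigr => x _; ring.
Qed.

(** The coefficients of the products with F_(b + (A - V)): on the right, those
    from the closed form of the alternating sum and from the operators C_j with
    j = c - b. The two cases b < c and b >= c are those of alpha_termE. *)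
Lemma alpha_identity V b : (0 < b)%N -> (forall x, x \in V -> (c <= v x)%N) ->
  \sum_(T : {set I} | T \subset V) alpha q v c T b * detach_coef q v (V :\: T) =
  (#|V|.-1)`!%:R * \sum_(x in V | (b <= v x)%N) q ^+ (c + lsum v V - b - 1)
  + (b < c)%:R * (q ^+ (c - b - 1) * detach_weight q v V).
Proof.
move=> b0 cV; rewrite alpha_detach_coef big_mkcondr /detach_weight !mulr_sumr -big_split /=.
apply: eq_bigr => x xV; have cx := cV x xV; have xl := leq_lsum v xV.
rewrite alpha_termE ?c0 //; case: ltnP => bc.
  have -> : (b <= v x)%N by lia.
  have -> : (c + lsum v V - b - 1 = (c - b - 1) + lsum v V)%N by lia.
  by rewrite exprD /=; ring.
rewrite mul0r addr0; case: leqP => bx; last by rewrite mul0r.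
by rewrite -exprD; congr (_ * _ ^+ _); lia.
Qed.

(** The coefficients of the products with F_(A - V). The q-integers of the values
    cancel between the two sums by sum_factS_detach, and the sums of
    alpha_term * q^b, called B below, collapse by sum_fact_card_detach. *)
Lemma beta_identity V N : (forall x, x \in V -> (c <= v x < N)%N) ->
  \sum_(T : {set I} | T \subset V)
     (\sum_(1 <= b < N) alpha q v c T b * detach_cons_coef q v b (V :\: T)
      + beta q v c T * detach_coef q v (V :\: T)) =
  #|V|`!%:R * (c + lsum v V)%:R * q ^+ (c + lsum v V).-1
  - \sum_(1 <= b < c) q ^+ (c - b - 1) * detach_cons_coef q v b V.
Proof.
move=> cV; set n := #|V|.
have cV' x : x \in V -> (c <= v x)%N by move/cV/andP=> [].
(* B x is the sum of the alpha_term q c (v x) b * q^b; M x is the sum that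
   cancels between E1 and E2. *)
pose B x : K := c.-1%:R * q ^+ c.-1 + ((v x).+1 - c)%:R * (q ^+ c.-1 * q ^+ v x).
pose M x : K := \sum_(T : {set I} | T \subset V :\ x)
  #|T|`!%:R * #|V :\ x :\: T|`!%:R * q ^+ lsum v (V :\ x :\: T).
have E1 : \sum_(T : {set I} | T \subset V)
     \sum_(1 <= b < N) alpha q v c T b * detach_cons_coef q v b (V :\: T) =
   \sum_(x in V) (B x * (n`!%:R * q ^+ (lsum v V - v x)) - qint q (v x) * M x).
  transitivity (\sum_(T : {set I} | T \subset V) \sum_(x in T)
    ((#|T|.-1)`!%:R * (B x * (#|V :\: T|`!%:R * q ^+ lsum v (V :\: T)
                   - #|V :\: T|%:R * detach_weight q v (V :\: T))
     - qint q (v x) * (#|V :\: T|`!%:R * q ^+ lsum v (V :\: T))))).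
    apply: eq_bigr => T sT; rewrite -mulr_sumr.
    under eq_bigr do rewrite alphaE -mulrA.
    rewrite -mulr_sumr; congr (_ * _).
    under eq_bigr do rewrite mulr_suml.
    rewrite exchange_big; apply: eq_bigr => x xT.
    have cx := cV x (subsetP sT x xT).
    rewrite -(sum_alpha_term cx) /B -(sum_alpha_term_pow cx) !mulr_suml -sumrB.
    by apply: eq_bigr => b _; rewrite /detach_cons_coef; ring.
  rewrite (exchange_sum_subset_mem V (fun x T =>
    ((#|T|.-1)`!%:R * (B x * (#|V :\: T|`!%:R * q ^+ lsum v (V :\: T)
                   - #|V :\: T|%:R * detach_weight q v (V :\: T))
     - qint q (v x) * (#|V :\: T|`!%:R * q ^+ lsum v (V :\: T)))))).
  apply: eq_bigr => x xV.
  have -> : (lsum v V - v x = lsum v (V :\ x))%N by rewrite (lsumD1 v xV) addKn.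
  have -> : (n = #|V :\ x|.+1)%N by rewrite /n (cardsD1 x V) xV.
  rewrite -sum_fact_card_detach /M !mulr_sumr -sumrB.
  apply: eq_bigr => T; rewrite subsetD1 => /andP[_ xT].
  by rewrite cardsU1 xT setDDl /=; ring.
have E2 : \sum_(T : {set I} | T \subset V) beta q v c T * detach_coef q v (V :\: T) =
   n`!%:R * qint q c * q ^+ lsum v V + \sum_(x in V) qint q (v x) * M x.
  rewrite (sum_detach_coef V (fun T => beta q v c T)) betaE //.
  have -> : \sum_(T : {set I} | T \subset V) beta q v c T * detach_weight q v (V :\: T) =
    qint q c * (n`!%:R * (1 - q ^+ lsum v V))
    + \sum_(x in V) qint q (v x) * (n`!%:R - M x).
    rewrite -sum_fact_detach mulr_sumr.
    have -> : \sum_(x in V) qint q (v x) * (n`!%:R - M x) =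
       \sum_(T : {set I} | T \subset V) \sum_(x in T)
          qint q (v x) * (#|T|`!%:R * detach_weight q v (V :\: T)).
      rewrite (exchange_sum_subset_mem V (fun x T =>
          qint q (v x) * (#|T|`!%:R * detach_weight q v (V :\: T)))).
      apply: eq_bigr => x xV; rewrite -mulr_sumr; congr (_ * _).
      have -> : (n = #|V :\ x|.+1)%N by rewrite /n (cardsD1 x V) xV.
      rewrite -sum_factS_detach; apply: eq_bigr => T; rewrite subsetD1 => /andP[_ xT].
      by rewrite cardsU1 xT setDDl.
    rewrite -big_split /=; apply: eq_bigr => T sT.
    rewrite betaE => [|x xT]; last by apply: cV'; exact: (subsetP sT).
    by rewrite -mulr_suml; ring.
  under [\sum_(x in V) _ * (_ - _)]eq_bigr do rewrite mulrBr.
  by rewrite sumrB -mulr_suml -/n; ring.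
have nD : n%:R * detach_weight q v V =
    n`!%:R * (\sum_(x in V) q ^+ (lsum v V - v x) - n%:R * q ^+ lsum v V).
  rewrite /detach_weight sumrB sumr_const -[q ^+ lsum v V *+ _]mulr_natl -/n.
  case: (posnP n) => n0.
    have V0 : V = set0 by apply/eqP; rewrite -cards_eq0 -/n n0.
    by rewrite n0 V0 big_set0; ring.
  by rewrite -[in RHS](prednK n0) factS natrM prednK //; ring.
have EU : \sum_(1 <= b < c) q ^+ (c - b - 1) * detach_cons_coef q v b V =
    - (n`!%:R * q ^+ lsum v V * (qint q c.-1 - c.-1%:R * q ^+ c.-1)
       + c.-1%:R * q ^+ c.-1 * (n%:R * detach_weight q v V)).
  have e b : (1 <= b < c)%N -> q ^+ (c - b - 1) * detach_cons_coef q v b V =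
     - (n`!%:R * q ^+ lsum v V) * (q ^+ (c - b - 1) - q ^+ c.-1)
     - q ^+ c.-1 * (n%:R * detach_weight q v V).
    move=> ?; have -> : q ^+ c.-1 = q ^+ (c - b - 1) * q ^+ b.
      by rewrite -exprD; congr (_ ^+ _); lia.
    by rewrite /detach_cons_coef -/n; ring.
  rewrite (eq_big_nat _ _ e) sumrB -mulr_sumr sumrB sum_pow_lt !sumr_const_nat subn1.
  by rewrite -[q ^+ c.-1 *+ _]mulr_natl -[(_ * _) *+ _]mulr_natl; ring.
have EB : \sum_(x in V) B x * (n`!%:R * q ^+ (lsum v V - v x)) =
    n`!%:R * q ^+ c.-1 * (c.-1%:R * \sum_(x in V) q ^+ (lsum v V - v x)
      + ((lsum v V)%:R - n%:R * c.-1%:R) * q ^+ lsum v V).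
  have -> : (lsum v V)%:R - n%:R * c.-1%:R = \sum_(x in V) ((v x).+1 - c)%:R :> K.
    rewrite /lsum natr_sum [n%:R * _]mulr_natl -sumr_const -sumrB.
    apply: eq_bigr => x xV; have := cV' x xV => cx.
    rewrite -natrB; [congr _%:R; lia|lia].
  rewrite mulr_sumr mulr_suml -big_split mulr_sumr; apply: eq_bigr => x xV.
  rewrite /B -[in X in _ = _ * (_ + _ * X)](subnKC (leq_lsum v xV)) exprD /=; ring.
rewrite big_split /= E1 E2 sumrB EB EU nD qint_pred.
have -> : (c + lsum v V).-1 = (c.-1 + lsum v V)%N by lia.
have -> : (c + lsum v V)%:R = c.-1%:R + 1 + (lsum v V)%:R :> K.
  by rewrite natr1 prednK // natrD.
by rewrite exprD; ring.
Qed.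

End CoefficientIdentities.

(** * The two expansions *)
Section ThetaExpansion.
Variables (K : fieldType) (q : K) (I : finType) (v : I -> nat).
Hypothesis char0 : [pchar K] =i pred0.
Hypothesis q0 : q != 0.
Variables (A : {set I}) (c : nat).
Hypothesis c0 : (0 < c)%N.
Hypothesis cA : forall x, x \in A -> (c <= v x)%N.
Implicit Types (T U V W : {set I}).

Local Notation F := (Ftilde K).
Local Notation N := (c + lsum v A).+1.

Lemma v_gt0 x : x \in A -> (0 < v x)%N.
Proof. by move/cA; apply: leq_trans. Qed.

Lemma signed_hsymf_hnorm n : (0 < n)%N -> signed_hsymf K n = q ^+ n.-1 *: hnorm q n.
Proof.
case: n => // n _; rewrite /signed_hsymf /hnorm scalerA /= (exprNn q^-1) exprVn.
by rewrite mulrCA mulfV ?expf_neq0 // mulr1 !exprS !mulN1r opprK.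
Qed.

Definition plain_term V : symfun K :=
  hnorm q (c + lsum v V) * F (lvalues v (A :\: V)).
Definition cons_term V b : symfun K :=
  hnorm q (c + lsum v V - b) * F (b :: lvalues v (A :\: V)).

(** The terms of the operators in which nothing is removed make up, together
    with F_(A + c), the alternating sum; all others remove a nonempty set or
    the element c - j. *)
Lemma Theta_hnorm :
  Theta q v A c =
  \sum_(V : {set I} | V \subset A)
    (\sum_(1 <= b < N)
       ((#|V|.-1)`!%:R * \sum_(x in V | (b <= v x)%N) q ^+ (c + lsum v V - b - 1)
        + (b < c)%:R * (q ^+ (c - b - 1) * detach_weight q v V)) *: cons_term V b
     + (#|V|`!%:R * (c + lsum v V)%:R * q ^+ (c + lsum v V).-1
        - \sum_(1 <= b < c) q ^+ (c - b - 1) * detach_cons_coef q v b V) *: plain_term V).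
Proof.
have lA V : V \subset A -> (lsum v V <= lsum v A)%N.
  by move=> /(lsumDS v)->; rewrite leq_addr.
have step b : (1 <= b < c)%N -> q ^+ (c - b).-1 *: Cop q (c - b) (F (b :: lvalues v A)) =
    signed_hsymf K (c - b) * F (b :: lvalues v A)
    - (\sum_(V : {set I} | V \subset A) (q ^+ (c - b - 1) * detach_weight q v V) *: cons_term V b
      - \sum_(V : {set I} | V \subset A) (q ^+ (c - b - 1) * detach_cons_coef q v b V) *: plain_term V).
  move=> hb; rewrite (Cop_cons char0 q0 _ _ v_gt0); [|lia|lia].
  rewrite scalerDr opprB addrCA addrC; congr (_ + _); last first.
    rewrite scaler_sumr; apply: eq_bigr => V sV; rewrite scalerA subn1 /plain_term.
    by congr (_ *: (hnorm _ _ * _)); lia.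
  have -> : \sum_(V : {set I} | V \subset A) detach_coef q v V *:
      (hnorm q (c - b + lsum v V) * F (b :: lvalues v (A :\: V))) =
    \sum_(V : {set I} | V \subset A) ((V == set0)%:R *: cons_term V b - detach_weight q v V *: cons_term V b).
    apply: eq_bigr => V sV; rewrite -scalerBl /cons_term.
    by congr (_ *: (hnorm _ _ * _)); lia.
  rewrite sumrB scalerBr; congr (_ - _).
    rewrite (bigD1 set0) ?sub0set //= eqxx scale1r big1 ?addr0 => [|V /andP[_ /negbTE->]].
      by rewrite /cons_term lsum0 addn0 setD0 signed_hsymf_hnorm ?scalerAl //; lia.
    by rewrite scale0r.
  by rewrite scaler_sumr; apply: eq_bigr => V _; rewrite scalerA subn1.
have E1 : Theta q v A c = altsum K v c A
  + (\sum_(V : {set I} | V \subset A) \sum_(1 <= b < c)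
        (q ^+ (c - b - 1) * detach_weight q v V) *: cons_term V b
     - \sum_(V : {set I} | V \subset A)
        (\sum_(1 <= b < c) q ^+ (c - b - 1) * detach_cons_coef q v b V) *: plain_term V).
  rewrite /Theta big_nat_rev /=.
  rewrite (eq_big_nat _ _ (F2 := fun b =>
    q ^+ (c - b).-1 *: Cop q (c - b) (F (b :: lvalues v A)))) => [|b hb]; last first.
    have -> : (1 + c - b.+1 = c - b)%N by lia.
    by have -> : (c - (c - b) = b)%N by lia.
  rewrite (eq_big_nat _ _ step) sumrB opprB sumrB.
  rewrite /altsum big_nat_recr //= subnn signed_hsymf0 mulN1r opprB.
  rewrite exchange_big /= -[RHS]addrA; congr (_ + _).
  rewrite addrC; congr (_ + _); congr (_ - _).
  rewrite exchange_big /=; apply: eq_bigr => V _; exact/esym/scaler_suml.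
rewrite E1 altsumE; last exact: v_gt0.
rewrite -sumrB -!big_split /=; apply: eq_bigr => V sV; have lV := lA V sV.
rewrite scalerBl [X in X + _ = _]addrC addrACA; congr (_ + (_ - _)); last first.
  by rewrite signed_hsymf_hnorm ?addn_gt0 ?c0 // -scalerAl scalerA.
under [RHS]eq_bigr do rewrite scalerDl.
rewrite big_split /=; congr (_ + _); last first.
  rewrite (big_nat_widen _ _ N) /=; last lia.
  rewrite big_mkcond; apply: eq_bigr => b _.
  by case: ltnP; rewrite ?mul1r // mul0r scale0r.
under [RHS]eq_bigr do rewrite mulr_sumr scaler_suml.
under [RHS]eq_bigr do rewrite big_mkcondr.
rewrite [RHS]exchange_big /=; apply: eq_bigr => x xV; have xl := leq_lsum v xV.
rewrite scaler_sumr (big_nat_widen _ (v x).+1 N) /=; last lia.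
rewrite [LHS]big_mkcond; apply: eq_big_nat => b hb; rewrite ltnS; case: leqP => // bx.
rewrite signed_hsymf_hnorm; last lia.
by rewrite -scalerAl scalerA subn1.
Qed.

Definition Cop_expansion : symfun K :=
    \sum_(T : {set I} | T \subset A)
      (\sum_(1 <= b < (lsum v T).+1)
          alpha q v c T b *:
            Cop q (c + lsum v T - b) (F (b :: lvalues v (A :\: T)))
       + beta q v c T *:
           Cop q (c + lsum v T) (F (lvalues v (A :\: T)))).

(** First T is chosen, then the subset U of the rest that is removed by the
    operator; regrouping by the union V of T and U. The range of b is extended
    to a bound independent of T, beyond which alpha vanishes. *)
Lemma Cop_expansion_hnorm : Cop_expansion =
  \sum_(V : {set I} | V \subset A)
    (\sum_(1 <= b < N)
       (\sum_(T : {set I} | T \subset V) alpha q v c T b * detach_coef q v (V :\: T))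
         *: cons_term V b
     + (\sum_(T : {set I} | T \subset V)
          (\sum_(1 <= b < N) alpha q v c T b * detach_cons_coef q v b (V :\: T)
           + beta q v c T * detach_coef q v (V :\: T))) *: plain_term V).
Proof.
have vD T x : x \in A :\: T -> (0 < v x)%N by move=> /setDP[/v_gt0].
have lA V : V \subset A -> (lsum v V <= lsum v A)%N.
  by move=> /(lsumDS v)->; rewrite leq_addr.
have lU T U : U \subset A :\: T -> lsum v (T :|: U) = (lsum v T + lsum v U)%N.
  move=> sU; rewrite (lsumDS v (subsetUl T U)); congr (_ + lsum v _)%N.
  rewrite setDUl setDv set0U; apply/setDidPl.
  by move: sU; rewrite subsetD => /andP[].
pose G T U := \sum_(1 <= b < N) (alpha q v c T b * detach_coef q v U) *: cons_term (T :|: U) b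
   + (\sum_(1 <= b < N) alpha q v c T b * detach_cons_coef q v b U + beta q v c T * detach_coef q v U)
       *: plain_term (T :|: U).
transitivity (\sum_(T : {set I} | T \subset A) \sum_(U : {set I} | U \subset A :\: T) G T U).
  apply: eq_bigr => T sT; have lT := lA T sT.
  have -> : \sum_(1 <= b < (lsum v T).+1) alpha q v c T b *:
      Cop q (c + lsum v T - b) (F (b :: lvalues v (A :\: T))) =
    \sum_(1 <= b < N) \sum_(U : {set I} | U \subset A :\: T)
      ((alpha q v c T b * detach_coef q v U) *: cons_term (T :|: U) b
       + (alpha q v c T b * detach_cons_coef q v b U) *: plain_term (T :|: U)).
    rewrite [RHS](big_cat_nat (n := (lsum v T).+1)) //=; last lia.
    rewrite [X in _ = _ + X]big1_seq ?addr0 => [|b]; last first.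
      rewrite mem_index_iota => /andP[_ hb]; have -> : alpha q v c T b = 0.
        rewrite alphaE big1 ?mulr0 // => x xT; rewrite /alpha_term ifF //.
        by have := leq_lsum v xT; lia.
      by rewrite big1 // => U _; rewrite !mul0r !scale0r addr0.
    apply: eq_big_nat => b hb.
    rewrite (Cop_cons char0 q0 _ _ (@vD T)); [|lia|lia].
    rewrite -big_split scaler_sumr; apply: eq_bigr => U sU /=.
    rewrite scalerDr !scalerA /cons_term /plain_term lU // setDDl.
    by congr (_ *: (hnorm _ _ * _) + _ *: (hnorm _ _ * _)); lia.
  rewrite (Cop_lvalues char0 q0 _ (@vD T)); last lia.
  rewrite exchange_big scaler_sumr -big_split; apply: eq_bigr => U sU /=.
  rewrite /G big_split /= -addrA; congr (_ + _).
  rewrite [RHS]scalerDl scaler_suml; congr (_ + _).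
  by rewrite scalerA /plain_term lU // setDDl addnA.
rewrite sum_subset_pair; apply: eq_bigr => V sV.
under eq_bigr => T sT.
  have -> : G T (V :\: T) = \sum_(1 <= b < N) (alpha q v c T b * detach_coef q v (V :\: T)) *: cons_term V b
   + (\sum_(1 <= b < N) alpha q v c T b * detach_cons_coef q v b (V :\: T)
      + beta q v c T * detach_coef q v (V :\: T)) *: plain_term V.
    by rewrite /G -[in RHS](setID V T) (setIidPr sT) setDUl setDv set0U setDDl setUid.
  over.
rewrite big_split /= exchange_big /= -scaler_suml; congr (_ + _).
by apply: eq_bigr => b _; rewrite scaler_suml.
Qed.

Theorem Theta_Cop_expansion : Theta q v A c = Cop_expansion.
Proof.
rewrite Theta_hnorm Cop_expansion_hnorm; apply: eq_bigr => V sV.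
have cV x : x \in V -> (c <= v x)%N by move=> /(subsetP sV)/cA.
congr (_ + _ *: _).
  by apply: eq_big_nat => b /andP[b0 _]; rewrite alpha_identity.
rewrite beta_identity // => x xV; rewrite cV //=.
by have := leq_lsum v (subsetP sV x xV); lia.
Qed.

End ThetaExpansion.

(** * Positivity and the base field *)
Section Positivity.
Variables (K : fieldType) (q : K).

Lemma in_NqD x y : in_Nq q x -> in_Nq q y -> in_Nq q (x + y).
Proof.
move=> [s ->] [t ->]; exists (mkseq (fun i => (nth 0 s i + nth 0 t i)%N) (maxn (size s) (size t))).
rewrite size_mkseq.
have ext (r : seq nat) m : (size r <= m)%N ->
    \sum_(i < size r) (nth 0%N r i)%:R * q ^+ i = \sum_(i < m) (nth 0%N r i)%:R * q ^+ i.
  move=> rm; rewrite (big_ord_widen m (fun i => (nth 0%N r i)%:R * q ^+ i)) //.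
  rewrite big_mkcond; apply: eq_bigr => i _; case: ltnP => // h.
  by rewrite nth_default // mul0r.
rewrite (ext s _ (leq_maxl _ (size t))) (ext t _ (leq_maxr (size s) _)) -big_split.
by apply: eq_bigr => i _; rewrite nth_mkseq //= natrD mulrDl.
Qed.

Lemma in_Nq0 : in_Nq q 0.
Proof. by exists [::]; rewrite big_ord0. Qed.

Lemma in_NqX n : in_Nq q (q ^+ n).
Proof.
exists (rcons (nseq n 0%N) 1%N); rewrite size_rcons size_nseq big_ord_recr /=.
rewrite big1 ?add0r => [|i _]; last by rewrite nth_rcons size_nseq ltn_ord nth_nseq ltn_ord mul0r.
by rewrite nth_rcons size_nseq ltnn eqxx mul1r.
Qed.

Lemma in_Nq_natM n x : in_Nq q x -> in_Nq q (n%:R * x).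
Proof.
move=> hx; elim: n => [|n IH]; first by rewrite mul0r; exact: in_Nq0.
by rewrite -natr1 mulrDl mul1r; exact: in_NqD.
Qed.

Lemma in_Nq_sum (J : Type) (r : seq J) (P : pred J) (f : J -> K) :
  (forall j, P j -> in_Nq q (f j)) -> in_Nq q (\sum_(j <- r | P j) f j).
Proof. by move=> H; apply: (big_ind (in_Nq q)); [exact: in_Nq0|exact: in_NqD|]. Qed.

Variables (I : finType) (v : I -> nat) (c : nat).

Lemma in_Nq_alpha (T : {set I}) b : in_Nq q (alpha q v c T b).
Proof.
rewrite /alpha; case: ifP => _; first exact: in_Nq0.
by apply: in_Nq_natM; apply: in_Nq_sum => x _; exact: in_NqX.
Qed.

Lemma in_Nq_beta (T : {set I}) : in_Nq q (beta q v c T).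
Proof.
apply: in_NqD; apply: in_Nq_natM; apply: in_Nq_sum => x _; first exact: in_NqX.
by apply: in_Nq_sum => i _; exact: in_NqX.
Qed.

End Positivity.

Lemma Qqt_pchar0 : [pchar Qqt] =i pred0.
Proof.
apply/pcharf0P => n.
have -> : n%:R = tofrac (n%:R : {mpoly rat[2]}) :> Qqt by rewrite rmorph_nat.
rewrite -(rmorph0 (@tofrac {mpoly rat[2]})) tofrac_eq.
rewrite -mpolyC_nat mpolyC_eq0.
by rewrite Num.Theory.pnatr_eq0.
Qed.

Lemma q_neq0 : q_ != 0.
Proof.
rewrite /q_ -(rmorph0 (@tofrac {mpoly rat[2]})) tofrac_eq; apply/eqP => e.
have := congr1 (mcoeff U_(ord0)) e; rewrite mcoeffXU eqxx mcoeff0 => /eqP.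
by rewrite oner_eq0.
Qed.

Theorem theorem4p1 (I : finType) (v : I -> nat) (A : {set I}) (c : nat)
    (v_pos : forall x, x \in A -> (0 < v x)%N)
    (c_ge1 : (1 <= c)%N)
    (c_min : forall x, x \in A -> (c <= v x)%N) :
  Theta q_ v A c =
    \sum_(T : {set I} | T \subset A)
      (\sum_(1 <= b < (lsum v T).+1)
          alpha q_ v c T b *:
            Cop q_ (c + lsum v T - b) (Ftilde Qqt (b :: lvalues v (A :\: T)))
       + beta q_ v c T *:
           Cop q_ (c + lsum v T) (Ftilde Qqt (lvalues v (A :\: T))))
  /\ (forall T : {set I}, T \subset A ->
        (forall b : nat, (1 <= b <= lsum v T)%N ->
           in_Nq q_ (alpha q_ v c T b))
        /\ in_Nq q_ (beta q_ v c T)).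
Proof.
split; first exact: (Theta_Cop_expansion Qqt_pchar0 q_neq0 c_ge1 c_min).
by move=> T _; split=> [b _|]; [exact: in_Nq_alpha|exact: in_Nq_beta].
Qed.
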